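(* Let $A$ be a scalar type spectral operator in a complex Banach space $(X,\|\cdot\|)$ with spectral measure $E_A(\cdot)$. Then, for each bounded weak solution $y(\cdot)$ of the equation $y'(t)=Ay(t)$, $t\ge0$, $$\lim_{t\to\infty}\frac{1}{t}\int_0^t y(s)\,ds=Py(0)$$ in the norm of $X$, where $P=E_A(\{0\})$ is the projection onto $\ker A$ along $\overline{R(A)}$. If, moreover, the spectrum of $A$ contains no pure imaginary values, then, for each bounded weak solution $y(\cdot)$ of this equation, $$\lim_{t\to\infty}y(t)=Py(0)$$ in the norm of $X$.
   Context: A weak solution of $y'(t)=Ay(t)$, $t\ge0$, with $A$ a closed linear operator with domain $D(A)\subseteq X$, is a norm-continuous function $y:[0,\infty)\to X$ such that, for all $t\ge 0$, $\int_0^t y(s)\,ds\in D(A)$ and $y(t)=y(0)+A\int_0^t y(s)\,ds$. It is bounded if $\sup_{t\ge0}\|y(t)\|<\infty$. $\ker A$ is the kernel of $A$ and $\overline{R(A)}$ is the closure of its range. A scalar type spectral operator (in the sense of Dunford) in $X$ is a (possibly unbounded) closed linear operator $A$ for which there is a spectral measure (resolution of the identity) $E_A(\cdot)$, i.e. a map from the Borel sets of $\mathbb{C}$ to bounded linear projections on $X$ that is countably additive in the strong operator topology and satisfies $E_A(\mathbb{C})=I$ and $E_A(\delta\cap\sigma)=E_A(\delta)E_A(\sigma)$ for all Borel $\delta,\sigma$, with support equal to the spectrum $\sigma(A)$ (so $E_A(\sigma(A))=I$), such that $$A=\int_{\sigma(A)}\lambda\,dE_A(\lambda).$$ Here, for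 a bounded Borel function $F$, $\int F\,dE_A$ is the bounded operator obtained as the operator-norm limit of integrals of simple functions converging uniformly to $F$; for a general Borel function $F:\sigma(A)\to\mathbb{C}$, setting $F_n=F\chi_{\{\lambda\in\sigma(A):\,|F(\lambda)|\le n\}}$, the operator $F(A)=\int_{\sigma(A)} F\,dE_A$ is defined by $F(A)f=\lim_{n\to\infty}\int_{\sigma(A)} F_n\,dE_A\, f$ with domain the set of all $f\in X$ for which this norm limit exists. ''Pure imaginary values'' are the elements of $i\mathbb{R}\setminus\{0\}$ (so $0$ is allowed to be in the spectrum). *)

(* Defs.v *)
From mathcomp Require Import all_boot all_order all_algebra.
From mathcomp Require Import all_classical all_reals all_analysis.
From mathcomp Require Import complex.

Set Implicit Arguments.
Unset Strict Implicit.
Unset Printing Implicit Defensive.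

Import Order.TTheory GRing.Theory Num.Theory.
Import numFieldNormedType.Exports.

Local Open Scope classical_set_scope.
Local Open Scope ring_scope.
Local Open Scope complex_scope.

(** The values of [app] outside [dom] carry no meaning. *)
Record partial_op (X : Type) := PartialOp { dom : set X ; app :> X -> X }.

Section unbounded_operators.
Context {R : realType} {X : normedModType R[i]}.
Implicit Types A B : partial_op X.

Definition eq_partial_op A B : Prop :=
  dom A = dom B /\ forall x, dom A x -> A x = B x.

Definition partial_linear A : Prop :=
  dom A 0 /\
  forall (c : R[i]) u v, dom A u -> dom A v ->
    dom A (c *: u + v) /\ A (c *: u + v) = c *: A u + A v.

Definition op_graph A : set (X * X) := [set p | dom A p.1 /\ p.2 = A p.1].

Definition closed_linear_op A : Prop := partial_linear A /\ closed (op_graph A).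

Definition op_ker A : set X := [set x | dom A x /\ A x = 0].

Definition op_range A : set X := A @` dom A.

Definition resolvent_set A : set R[i] :=
  [set z | exists2 S : {linear X -> X}, continuous S &
    (forall x, dom A (S x) /\ A (S x) - z *: S x = x) /\
    (forall x, dom A x -> S (A x - z *: x) = x)].

Definition spectrum A : set R[i] := ~` resolvent_set A.

Definition projection_onto_along (P : {linear X -> X}) (M N : set X) : Prop :=
  [/\ forall x, P (P x) = P x, range P = M & P @^-1` [set 0] = N].

End unbounded_operators.

Definition pure_imaginary {R : realType} : set R[i] :=
  [set 0 +i* b | b in [set b : R | b != 0]].

(** The norm topology is declared on the alias [R[i]^o] of [R[i]]. *)
Definition borelC (R : realType) := g_sigma_algebraType (@open R[i]^o).

Section spectral_measures.
Context {R : realType} {X : normedModType R[i]}.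

(** [E] is a total function on sets of complex numbers, but only its values on
    Borel sets matter. That each [E D] is a projection is the case [D = D'] of
    the multiplicativity condition. *)
Record spectral_measure (E : set R[i] -> {linear X -> X}) : Prop :=
  SpectralMeasure {
    spectral_measure_continuous : forall D : set (borelC R),
      measurable D -> continuous (E D) ;
    spectral_measure_sigma_additive : forall D : nat -> set (borelC R),
      (forall n, measurable (D n)) -> trivIset setT D ->
      forall x, \sum_(0 <= k < n) E (D k) x @[n --> \oo] --> E (\bigcup_n D n) x ;
    spectral_measureT : forall x, E setT x = x ;
    spectral_measureI : forall D D' : set (borelC R),
      measurable D -> measurable D' ->
      forall x, E (D `&` D') x = E D (E D' x)
  }.

Variable E : set R[i] -> {linear X -> X}.

Definition spectral_support : set R[i] :=
  [set z | forall U : set R[i]^o, open U -> U z -> exists x, E U x != 0].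

Definition simple_function (s : borelC R -> borelC R) : Prop :=
  measurable_fun setT s /\ finite_set (range s).

Definition simple_integral (s : R[i] -> R[i]) (x : X) : X :=
  \sum_(z \in range s) z *: E (s @^-1` [set z]) x.

Definition is_bounded_integral (F : R[i] -> R[i]) (T : X -> X) : Prop :=
  exists s : nat -> R[i] -> R[i],
    [/\ forall n, simple_function (s n),
        forall e : R[i], 0 < e ->
          \forall n \near \oo, forall z, `|s n z - F z| <= e
      & forall e : R[i], 0 < e ->
          \forall n \near \oo, forall x,
            `|simple_integral (s n) x - T x| <= e * `|x| ].

(** A default value is returned when [F] is not a uniform limit of simple
    functions, i.e. not a bounded Borel function. *)
Definition bounded_integral (F : R[i] -> R[i]) : X -> X :=
  get (is_bounded_integral F).

(** [F_n], extended by [0] outside [S]. *)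
Definition truncation (S : set R[i]) (F : R[i] -> R[i]) (n : nat) (z : R[i]) : R[i] :=
  F z * \1_[set w | S w /\ `|F w| <= n%:R] z.

Definition spectral_integral (S : set R[i]) (F : R[i] -> R[i]) : partial_op X :=
  {| dom := [set x | cvg (bounded_integral (truncation S F n) x @[n --> \oo])] ;
     app := fun x => lim (bounded_integral (truncation S F n) x @[n --> \oo]) |}.

End spectral_measures.

Definition scalar_type_spectral {R : realType} {X : normedModType R[i]}
    (A : partial_op X) (E : set R[i] -> {linear X -> X}) : Prop :=
  [/\ closed_linear_op A, spectral_measure E, spectral_support E = spectrum A
    & eq_partial_op A (spectral_integral E (spectrum A) id)].

Section riemann_integral.
Context {R : realType} {X : normedModType R[i]}.
Implicit Types (y : R -> X) (a b : R).

Definition tagged_partition a b (n : nat) (x xi : nat -> R) : Prop :=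
  [/\ x 0%N = a, x n = b & forall k, (k < n)%N -> x k <= xi k <= x k.+1].

Definition riemann_sum y (n : nat) (x xi : nat -> R) : X :=
  \sum_(0 <= k < n) (x k.+1 - x k)%:C *: y (xi k).

(** Meaningful for [a <= b]: otherwise there is no tagged partition. *)
Definition is_riemann_integral y a b (v : X) : Prop :=
  forall e : R, 0 < e -> exists2 d : R, 0 < d &
    forall n x xi, tagged_partition a b n x xi ->
      (forall k, (k < n)%N -> x k.+1 - x k < d) ->
      `|riemann_sum y n x xi - v| < e%:C.

Definition riemann_integral y a b : X := get (is_riemann_integral y a b).

End riemann_integral.

Section weak_solutions.
Context {R : realType} {X : normedModType R[i]}.

Definition weak_solution (A : partial_op X) (y : R -> X) : Prop :=
  {within `[0, +oo[, continuous y} /\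
  forall t : R, 0 <= t ->
    dom A (riemann_integral y 0 t) /\
    y t = y 0 + A (riemann_integral y 0 t).

Definition bounded_weak_solution (A : partial_op X) (y : R -> X) : Prop :=
  weak_solution A y /\ exists M : R, forall t : R, 0 <= t -> `|y t| <= M%:C.

End weak_solutions.

(* Main.v *)
Require Import Defs.
From mathcomp Require Import all_boot all_order all_algebra.
From mathcomp Require Import all_classical all_reals all_analysis.
From mathcomp Require Import complex.
From mathcomp Require Import ring lra.

(** The solution is compared with the operator in the parts of [X] on which the
    operator is bounded. For a Borel set [D] that is a bounded part of the spectrum,
    the range of [E D] is invariant under [A], and there [A] is a norm limit of
    operators [simple_integral E s] with [s] simple and uniformly close to the
    identity on [D] ([app_approx]). The integral of a simple function is bounded by a
    constant [C] times the supremum of the function over [D], with the same [C] for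
    all [D] ([simple_integral_bounded]). This follows from the uniform boundedness of
    [E] ([spec_uniform_bounded]) and a convexity argument.

    If [y] is a weak solution, then [w = E D y] satisfies [w' = A w] in integrated
    form, with [A] bounded on the range of [E D]. Euler's method with [k] steps of
    length [h = t / k] approximates [w t] by the operator with symbol
    [(1 + h * s) ^+ k] applied to [w 0], and the bound above reduces the norm of this
    operator to the scalar inequality
    [|1 + h z| <= 1 / (1 + h * (eps - o(1)))] for [Re z <= - eps]. In the limit
    [euler_decay] yields [nm (w t) <= 2 C / (1 + t * eps) * nm (w 0)], without
    exponentials of operators. It has three uses. Run backwards on [eps <= Re z], it
    shows that a bounded solution has no component in the open right half plane
    ([solution_left_half_plane]). With [eps = 0], it bounds [E D (y t)] by
    [2 C * nm (E D (y 0))] for every Borel set [D] ([solution_uniform]), so that the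
    components of [y t] outside large sets are small uniformly in [t]. With
    [eps > 0], it gives decay in the open left half plane ([solution_decay]).

    The component [E [set 0] (y t)] is constant, as [A] vanishes on the range of
    [E [set 0]]. On an annulus [1 / (n + 1) <= |z| <= n] the operator [A] is bounded
    below ([app_bounded_below]), and [A] maps [E D] of the integral of [y] to the
    bounded function [E D (y t) - E D (y 0)], so that the mean of this component tends
    to [0]. Without imaginary spectrum, the remaining components of [y] lie in the open
    left half plane and decay. Since [x - E [set 0] x] is the limit of the components
    of [x] in the annuli, the lower bound and the density of the range there
    ([range_dense]) also identify the kernel of [A] and the closure of its range. *)

Set Implicit Arguments.
Unset Strict Implicit.
Unset Printing Implicit Defensive.

Import Order.TTheory GRing.Theory Num.Theory.
Import numFieldNormedType.Exports.
Import ComplexField.Normc.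

Local Open Scope classical_set_scope.
Local Open Scope ring_scope.
Local Open Scope complex_scope.

(** * The norms of complex numbers and of vectors, read in the real field *)

Section complex_modulus.
Context {R : realType}.
Implicit Types (z w : R[i]).

Lemma normcR (r : R) : normc r%:C = `|r|.
Proof. by rewrite /normc /= expr0n addr0 sqrtr_sqr. Qed.

Lemma normc_ge0 (z : R[i]) : 0 <= normc z.
Proof. by case: z => a b; rewrite /= sqrtr_ge0. Qed.

Lemma gt0_complexP (e : R[i]) : 0 < e -> exists2 r : R, 0 < r & e = r%:C.
Proof.
case: e => a b; rewrite ltcE /= => /andP[/eqP -> a0].
by exists a.
Qed.

Lemma normE z : `|z| = (normc z)%:C.
Proof. by case: z. Qed.

Lemma normc_triangle z w : normc (z + w) <= normc z + normc w.
Proof. by rewrite -lecR rmorphD /= -!normE ler_normD. Qed.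

Lemma normc_opp z : normc (- z) = normc z.
Proof. by case: z => a b /=; rewrite !sqrrN. Qed.

Lemma normc_dist z w : `|normc z - normc w| <= normc (z - w).
Proof.
have := normc_triangle (z - w) w; have := normc_triangle (w - z) z.
rewrite !subrK -(opprB z w) normc_opp ler_norml => ? ?.
by apply/andP; split; lra.
Qed.

Lemma normc_ge_ReIm z : `|complex.Re z| <= normc z /\ `|complex.Im z| <= normc z.
Proof.
case: z => x y; split;
  by rewrite -sqrtr_sqr /= ler_sqrt ?addr_ge0 ?sqr_ge0// ?lerDl ?lerDr sqr_ge0.
Qed.

Lemma Re_dist z w : `|complex.Re z - complex.Re w| <= normc (z - w).
Proof.
by case: z => a b; case: w => c d; have [] := normc_ge_ReIm ((a +i* b) - (c +i* d)).
Qed.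

Lemma Im_dist z w : `|complex.Im z - complex.Im w| <= normc (z - w).
Proof.
by case: z => a b; case: w => c d; have [] := normc_ge_ReIm ((a +i* b) - (c +i* d)).
Qed.

Lemma normc_le_ReIm z : normc z <= `|complex.Re z| + `|complex.Im z|.
Proof.
case: z => x y /=; rewrite -(ger0_norm (addr_ge0 (normr_ge0 x) (normr_ge0 y))) -sqrtr_sqr.
rewrite ler_sqrt ?sqr_ge0// sqrrD !real_normK ?num_real//.
by rewrite addrAC lerDl mulrn_wge0// mulr_ge0.
Qed.

Lemma nbhs_normc (z : R[i]^o) (U : set R[i]^o) : nbhs z U <->
  exists2 e : R, 0 < e & forall w, normc (w - z) < e -> U w.
Proof.
split=> [/nbhs_ballP[e /= e0 eU]|[e e0 eU]].
  have [r r0 re] := gt0_complexP e0; exists r => // w wz; apply: eU.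
  by rewrite -ball_normE /ball_ /= distrC normE re ltcR.
apply/nbhs_ballP; exists (e%:C) => /=; first by rewrite ltcR.
by move=> w; rewrite -ball_normE /ball_ /= distrC normE ltcR => /eU.
Qed.

End complex_modulus.

Section real_norm.
Context {R : realType} {X : normedModType R[i]}.
Implicit Types (x y : X) (u : nat -> X).

(** The norm of [X] takes values in [R[i]], where the order is partial; estimates
    are made with its real part, which is the same number. *)
Definition nm x : R := complex.Re `|x|.

Lemma nmE x : `|x| = (nm x)%:C.
Proof. by rewrite /nm RRe_real // normr_real. Qed.

Lemma nm_ge0 x : 0 <= nm x.
Proof. by rewrite -lecR -nmE normr_ge0. Qed.

Lemma nm0 : nm 0 = 0.
Proof. by rewrite /nm normr0. Qed.

Lemma nm_eq0 x : nm x = 0 -> x = 0.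
Proof. by move=> x0; apply/normr0_eq0; rewrite nmE x0. Qed.

Lemma nmD x y : nm (x + y) <= nm x + nm y.
Proof. by rewrite -lecR rmorphD /= -!nmE ler_normD. Qed.

Lemma nmN x : nm (- x) = nm x.
Proof. by rewrite /nm normrN. Qed.

Lemma nmB x y : nm (x - y) <= nm x + nm y.
Proof. by rewrite -(nmN y) nmD. Qed.

Lemma nm_distC x y : nm (x - y) = nm (y - x).
Proof. by rewrite -opprB nmN. Qed.

Lemma nmZ (c : R[i]) x : nm (c *: x) = normc c * nm x.
Proof. by apply: complexI; rewrite rmorphM /= -!nmE normrZ. Qed.

Lemma nmZr (r : R) x : nm (r%:C *: x) = `|r| * nm x.
Proof. by rewrite nmZ normcR. Qed.

Lemma nm_dist x y z : nm (x - z) <= nm (x - y) + nm (y - z).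
Proof. by rewrite (le_trans _ (nmD _ _)) // addrA subrK. Qed.

Lemma nm_sum (I : Type) (r : seq I) (P : pred I) (F : I -> X) :
  nm (\sum_(i <- r | P i) F i) <= \sum_(i <- r | P i) nm (F i).
Proof.
elim/big_ind2 : _ => [|x a y b xa yb|//]; first by rewrite nm0.
by rewrite (le_trans (nmD _ _)) // lerD.
Qed.

Lemma nm_cvgP {T : Type} {F : set_system T} {FF : Filter F} (f : T -> X) l :
  f t @[t --> F] --> l <->
  forall e : R, 0 < e -> \forall t \near F, nm (f t - l) <= e.
Proof.
rewrite cvgrPdist_le; split=> h e e0.
  have ec0 : 0 < e%:C by rewrite ltcR.
  apply: filterS (h _ ec0) => t.
  by rewrite nmE lecR nm_distC.
have [r r0 ->] := gt0_complexP e0.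
by apply: filterS (h _ r0) => t; rewrite nmE lecR nm_distC.
Qed.

Lemma nm_cvgn u l : u n @[n --> \oo] --> l ->
  forall e : R, 0 < e -> exists N, forall n, (N <= n)%N -> nm (u n - l) <= e.
Proof.
move=> ul e e0; have : \forall n \near \oo, nm (u n - l) <= e.
  exact: ((nm_cvgP _ _).1 ul).
by case=> N _ hN; exists N => n Nn; apply: hN.
Qed.

Lemma nm_cvgn_le u l v (K : R) : u n @[n --> \oo] --> l ->
  (\forall n \near \oo, nm (u n - v) <= K) -> nm (l - v) <= K.
Proof.
move=> /nm_cvgn ul [M _ uK]; apply/ler_addgt0Pr => e e0.
have [N hN] := ul _ e0.
have := hN _ (leq_maxl N M); rewrite nm_distC.
have /= := uK _ (leq_maxr N M); set n := maxn N M => vN lN.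
by rewrite (le_trans (nm_dist _ (u n) _)) // addrC lerD.
Qed.

Lemma le0_nm_eq0 x : (forall e : R, 0 < e -> nm x <= e) -> x = 0.
Proof.
move=> h; apply: nm_eq0; apply/eqP; rewrite eq_le nm_ge0 andbT.
by apply/ler_addgt0Pr => e e0; rewrite add0r h.
Qed.

End real_norm.

Section linear_bounded.
Context {R : realType} {X : normedModType R[i]}.

Lemma nm_bounded_cvg {T : Type} {F : set_system T} {FF : Filter F}
    (L : {linear X -> X}) (K : R) (f : T -> X) l :
  (forall x, nm (L x) <= K * nm x) ->
  f t @[t --> F] --> l -> L (f t) @[t --> F] --> L l.
Proof.
move=> LK /nm_cvgP fl; apply/nm_cvgP => e e0.
have K1 : 0 < `|K| + 1 by rewrite ltr_pwDr.
apply: filterS (fl (e / (`|K| + 1)) _) => [t ht|]; last by rewrite divr_gt0.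
rewrite -linearB (le_trans (LK _)) //.
apply: (@le_trans _ _ ((`|K| + 1) * nm (f t - l))).
  by rewrite ler_wpM2r ?nm_ge0// (le_trans (ler_norm _)) // lerDl.
by rewrite mulrC -ler_pdivlMr.
Qed.
End linear_bounded.

Section complete.
Context {R : realType} {X : completeNormedModType R[i]}.

Lemma nm_cauchy_cvg (u : nat -> X) :
  (forall e : R, 0 < e -> exists N, forall m n, (N <= m)%N -> (N <= n)%N ->
     nm (u m - u n) <= e) -> exists l : X, u n @[n --> \oo] --> l.
Proof.
move=> h; suff cu : cvg (u n @[n --> \oo]) by move/cvg_ex: cu.
apply/cauchy_cvgP/cauchy_ballP => e e0.
have [r r0 ->] := gt0_complexP e0.
have r20 : 0 < r / 2 by rewrite divr_gt0.
have [N hN] := h _ r20.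
exists ([set u n | n in [set n | (N <= n)%N]],
        [set u n | n in [set n | (N <= n)%N]]) => /=.
  by split; exists N => // n Nn; exists n.
move=> [a b] /= [[m Nm <-] [n Nn <-]].
rewrite -ball_normE /= /ball_ /= nmE ltcR.
by rewrite (le_lt_trans (hN _ _ Nm Nn)) // ltr_pdivrMr // ltr_pMr // ltr1n.
Qed.
End complete.

(** * Uniform boundedness of a spectral measure *)

Section borel_sets.
Context {R : realType}.

Definition borel_set (D : set R[i]) : Prop := measurable (D : set (borelC R)).

Lemma borel_setT : borel_set setT.
Proof. exact: measurableT. Qed.

Lemma borel_set0 : borel_set set0.
Proof. exact: measurable0. Qed.

Lemma borel_setC D : borel_set D -> borel_set (~` D).
Proof. exact: measurableC. Qed.

Lemma borel_setI D D' : borel_set D -> borel_set D' -> borel_set (D `&` D').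
Proof. exact: measurableI. Qed.

Lemma borel_setU D D' : borel_set D -> borel_set D' -> borel_set (D `|` D').
Proof. exact: measurableU. Qed.

Lemma borel_setD D D' : borel_set D -> borel_set D' -> borel_set (D `\` D').
Proof. exact: measurableD. Qed.

Lemma borel_bigcup (D : nat -> set R[i]) :
  (forall n, borel_set (D n)) -> borel_set (\bigcup_n D n).
Proof. by move=> h; apply: (@bigcupT_measurable _ (borelC R)). Qed.

Lemma borel_open (U : set R[i]^o) : open U -> borel_set U.
Proof. by move=> oU; apply: sub_sigma_algebra. Qed.

Lemma borel_closed (U : set R[i]^o) : closed U -> borel_set U.
Proof.
move=> cU; rewrite -(setCK U); apply: borel_setC; apply: borel_open.
exact: closed_openC.
Qed.

End borel_sets.

Section spectral_measure_basics.
Context {R : realType} {X : normedModType R[i]}.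
Context (E : set R[i] -> {linear X -> X}) (hE : spectral_measure E).
Implicit Types (D : set R[i]) (x : X).

Lemma specI D D' x : borel_set D -> borel_set D' ->
  E D (E D' x) = E (D `&` D') x.
Proof. by move=> mD mD'; rewrite (spectral_measureI hE). Qed.

Lemma specC D D' x : borel_set D -> borel_set D' ->
  E D (E D' x) = E D' (E D x).
Proof. by move=> mD mD'; rewrite !specI// setIC. Qed.

Lemma spec_sub D D' x : borel_set D -> borel_set D' -> D `<=` D' ->
  E D (E D' x) = E D x.
Proof. by move=> mD mD' /setIidl DD'; rewrite specI// DD'. Qed.

Lemma spec_id D x : borel_set D -> E D (E D x) = E D x.
Proof. by move=> mD; rewrite spec_sub. Qed.

Lemma spec_sumcvg (D : nat -> set R[i]) x :
  (forall n, borel_set (D n)) -> trivIset setT D ->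
  \sum_(0 <= k < n) E (D k) x @[n --> \oo] --> E (\bigcup_n D n) x.
Proof. by move=> mD tD; apply: (spectral_measure_sigma_additive hE). Qed.

Lemma spec0 x : E set0 x = 0.
Proof.
have /nm_cvgn h := @spec_sumcvg (fun=> set0) x (fun=> borel_set0) (@trivIset_set0 _ _ _).
apply: le0_nm_eq0 => e e0.
have [N hN] := h (e / 2) (divr_gt0 e0 (ltr0Sn _ _)).
have := lerD (hN _ (leqnSn N)) (hN _ (leqnn N)).
rewrite -splitr; apply: le_trans.
apply: le_trans (nmB _ _).
by rewrite opprB addrA subrK big_nat_recr//= addrC addKr.
Qed.

Lemma specU D D' x : borel_set D -> borel_set D' -> D `&` D' = set0 ->
  E (D `|` D') x = E D x + E D' x.
Proof.
move=> mD mD' DD'.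
have mB n : borel_set (bigcup2 D D' n).
  by case: n => [|[|n]] //=; exact: borel_set0.
have := @spec_sumcvg _ x mB; rewrite -trivIset_bigcup2 bigcup2E => /(_ DD').
move=> /nm_cvgn h.
apply/eqP; rewrite -subr_eq0; apply/eqP/le0_nm_eq0 => e e0.
have [N hN] := h e e0.
have := hN N.+2 (leq_trans (leqnSn N) (leqnSn _)).
rewrite big_nat_recl// big_nat_recl//= big1 ?addr0; first by rewrite nm_distC.
by move=> i _; rewrite spec0.
Qed.

Lemma spec_diff D D' x : borel_set D -> borel_set D' -> D `<=` D' ->
  E (D' `\` D) x = E D' x - E D x.
Proof.
move=> mD mD' DD'.
have -> : E D' x = E (D `|` D' `\` D) x by rewrite setDUK.
rewrite specU//; first by rewrite addrC addKr.
- exact: borel_setD.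
- by rewrite setDE setICA setICr setI0.
Qed.

Lemma spec_setC D x : borel_set D -> E (~` D) x = x - E D x.
Proof.
move=> mD; rewrite -setTD spec_diff//; last exact: borel_setT.
by rewrite (spectral_measureT hE).
Qed.

Lemma spec_setID D D' x : borel_set D -> borel_set D' ->
  E D x = E (D `&` D') x + E (D `\` D') x.
Proof.
move=> mD mD'; rewrite -specU ?setUIDK//; first exact: borel_setI.
- exact: borel_setD.
- by rewrite setDE setIACA setICr setI0.
Qed.

Lemma spec_cvg_nondecreasing (D : nat -> set R[i]) x :
  (forall n, borel_set (D n)) -> (forall n, D n `<=` D n.+1) ->
  E (D n) x @[n --> \oo] --> E (\bigcup_n D n) x.
Proof.
move=> mD sD.
have homoD : {homo D : n m / (n <= m)%N >-> (n <= m)%O}.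
  by apply: homo_leq => [//|A B C|n]; rewrite ?subsetEset//; exact: subset_trans.
have mS n : borel_set (seqD D n).
  by case: n => [|n]; [exact: mD|exact: borel_setD].
have := @spec_sumcvg _ x mS (trivIset_seqD homoD).
rewrite eq_bigcup_seqD => /nm_cvgn h.
have sumE n : \sum_(0 <= k < n.+1) E (seqD D k) x = E (D n) x.
  elim: n => [|n IH]; first by rewrite big_nat1.
  by rewrite big_nat_recr//= IH spec_diff// addrC subrK.
apply/nm_cvgP => e e0; have [N hN] := h e e0.
by exists N => // n /= Nn; rewrite -sumE; apply: hN; exact: leqW.
Qed.

(** Disjoint pieces of null sets are null, because [E] is multiplicative. *)
Lemma spec_null_bigcup (D : nat -> set R[i]) :
  (forall n, borel_set (D n)) -> (forall n x, E (D n) x = 0) ->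
  forall x, E (\bigcup_n D n) x = 0.
Proof.
move=> mD D0 x.
have mS n : borel_set (seqDU D n) by exact: (@seqDU_measurable _ (borelC R)).
have := @spec_sumcvg _ x mS (trivIset_seqDU D); rewrite -seqDU_bigcup_eq.
move=> /nm_cvgn h; apply: le0_nm_eq0 => e /h[N] /(_ _ (leqnn N)).
rewrite big1 ?sub0r ?nmN// => k _.
by rewrite -(spec_sub _ (mS k) (mD k) (@subset_seqDU _ _ _)) D0 linear0.
Qed.

(** If [E D x] is unbounded for [D] within [V], some [B] within [V] makes both
    [E B x] and [E (V `\` B) x] of norm at least [1], and [E D x] remains unbounded
    within [B] or within its complement in [V]. Discarding the other half at every
    step yields disjoint sets with terms of norm at least [1], against the
    convergence of their sum. *)
Lemma spec_pointwise_bounded x :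
  exists K, forall D, borel_set D -> nm (E D x) <= K.
Proof.
pose bdd V K := forall D, borel_set D -> D `<=` V -> nm (E D x) <= K.
apply/not_existsP => unb.
pose U V := borel_set V /\ forall K, ~ bdd V K.
have UT : U setT.
  split=> [|K hK]; first exact: borel_setT.
  by apply: (unb K) => D mD; apply: hK.
have step V : exists V', U V ->
    [/\ U V', V' `<=` V & 1 <= nm (E (V `\` V') x)].
  have [[mV uV]|?] := pselect (U V); last by exists V.
  have /existsNP[B /not_implyP[mB /not_implyP[BV /negP]]] := uV (nm (E V x) + 1).
  rewrite -ltNge => BK.
  have B1 : 1 <= nm (E B x) by apply: le_trans (ltW BK); rewrite lerDr nm_ge0.
  have VB1 : 1 <= nm (E (V `\` B) x).
    rewrite spec_diff// -(lerD2l (nm (E V x))) (le_trans (ltW BK))//.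
    by rewrite -{1}(subKr (E V x) (E B x)); apply: nmB.
  have [[K1 K1B]|B_unb] := pselect (exists K, bdd B K).
    exists (V `\` B) => _; split.
    - split=> [|K hK]; first exact: borel_setD.
      apply: (uV (K1 + K)) => D mD DV.
      rewrite (spec_setID _ mD mB) (le_trans (nmD _ _))// lerD//.
        by apply: K1B; [exact: borel_setI|exact: subIsetr].
      by apply: hK; [exact: borel_setD|exact: setSD].
    - exact: subDsetl.
    - by rewrite setDD setIidr.
  by exists B => _; split=> //; split=> // K hK; apply: B_unb; exists K.
have [f fP] := choice step.
pose V n := iter n f setT.
have UV n : U (V n) by elim: n => [|n /fP[]].
have sV n : V n.+1 `<=` V n by have [] := fP _ (UV n).
have homoV m n : (m <= n)%N -> V n `<=` V m.
  elim: n => [|n IH]; first by rewrite leqn0 => /eqP->.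
  rewrite leq_eqVlt => /orP[/eqP->//|]; rewrite ltnS => /IH.
  exact: subset_trans.
pose D n := V n `\` V n.+1.
have mD n : borel_set (D n) by apply: borel_setD; [case: (UV n)|case: (UV n.+1)].
have tD : trivIset setT D.
  apply: ltn_trivIset => n m mn; apply/seteqP; split=> // z [[_ h1] [h2 _]].
  by apply: h1; apply: homoV h2.
have := @spec_sumcvg _ x mD tD => /nm_cvgn h.
have [N hN] := h (1 / 4) (divr_gt0 ltr01 (ltr0Sn _ _)).
have := lerD (hN _ (leqnSn N)) (hN _ (leqnn N)).
apply/negP; rewrite -ltNge; apply: (@lt_le_trans _ _ 1); first by lra.
apply: le_trans (nmB _ _).
rewrite opprB addrA subrK big_nat_recr//= addrC addKr.
by have [] := fP _ (UV N).
Qed.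

End spectral_measure_basics.

Section uniform_bound.
Context {R : realType} {X : completeNormedModType R[i]}.
Context (E : set R[i] -> {linear X -> X}) (hE : spectral_measure E).

(** A gliding hump argument: if no uniform bound exists, every ball contains a
    smaller closed ball on which some [E D] is larger than [n], and the point common
    to a nested sequence of such balls contradicts pointwise boundedness. *)
Lemma spec_uniform_bounded :
  exists2 M : R, 0 <= M & forall D x, borel_set D -> nm (E D x) <= M * nm x.
Proof.
apply: contrapT => unb.
have large (x : X) (r K : R) : 0 < r -> exists D x',
    [/\ borel_set D, nm (x' - x) <= r / 2 & K < nm (E D x')].
  move=> r0; apply: contrapT => h.
  have bK D x' : borel_set D -> nm (x' - x) <= r / 2 -> nm (E D x') <= `|K|.
    move=> mD x'x; rewrite leNgt; apply/negP => K'; apply: h; exists D, x'.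
    by split=> //; exact: le_lt_trans (ler_norm K) K'.
  apply: unb; exists (4 * `|K| / r) => [|D v mD].
    by rewrite divr_ge0 ?mulr_ge0// ltW.
  have [v0|v0] := eqVneq (nm v) 0.
    by rewrite (nm_eq0 v0) linear0 nm0 mulr0.
  have nv0 : 0 < nm v by rewrite lt_def v0 nm_ge0.
  (* [c *: v] has norm [r / 2], so that [x + c *: v] stays in the ball *)
  pose c := r / 2 / nm v.
  have c0 : 0 < c by rewrite !divr_gt0.
  have h1 : nm (E D (x + c%:C *: v)) <= `|K|.
    apply: bK => //; rewrite [x + _]addrC addrK nmZr gtr0_norm// /c.
    by rewrite mulfVK// gt_eqF.
  have h2 : nm (E D x) <= `|K|.
    by apply: bK => //; rewrite subrr nm0 ltW// divr_gt0.
  have : nm (E D (c%:C *: v)) <= `|K| + `|K|.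
    have -> : c%:C *: v = (x + c%:C *: v) - x by rewrite addrC addKr.
    rewrite linearB.
    by apply: le_trans (nmB _ _) _; rewrite lerD.
  rewrite linearZ /= nmZr gtr0_norm// mulrC -ler_pdivlMr//.
  move=> /le_trans; apply; rewrite /c le_eqVlt; apply/orP; left; apply/eqP.
  by field; rewrite v0 gt_eqF.
have step (p : X * R) (n : nat) : exists q : X * R, 0 < p.2 ->
    [/\ 0 < q.2, q.2 <= n.+1%:R^-1,
      forall z, nm (z - q.1) <= q.2 -> nm (z - p.1) <= p.2
      & exists2 D, borel_set D &
        forall z, nm (z - q.1) <= q.2 -> n%:R < nm (E D z)].
  have [r0|?] := ltP 0 p.2; last by exists p.
  have [D [x' [mD x'x KD]]] := large p.1 p.2 (n%:R + 1) r0.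
  have : E D z @[z --> x'] --> E D x' by apply: (spectral_measure_continuous hE).
  move=> /nm_cvgP /(_ (1 / 2) (divr_gt0 ltr01 (ltr0Sn _ _))).
  move=> /nbhs_ballP[e /= e0 he].
  have [d d0 de] := gt0_complexP e0.
  pose q2 := Num.min (Num.min (d / 2) (p.2 / 2)) n.+1%:R^-1.
  have q20 : 0 < q2 by rewrite !lt_min !divr_gt0//= invr_gt0 ltr0Sn.
  exists (x', q2) => _; split=> //=.
  - by rewrite ge_min lexx orbT.
  - move=> z zq; apply: le_trans (nm_dist _ x' _) _.
    have : nm (z - x') <= p.2 / 2 by rewrite (le_trans zq)// !ge_min lexx orbT.
    lra.
  - exists D => // z zq.
    have /he /= : ball x' e z.
      rewrite -ball_normE /= nmE de ltcR nm_distC (le_lt_trans zq)//.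
      rewrite !gt_min; apply/orP; left; apply/orP; left; lra.
    have := nmB (E D x') (E D x' - E D z).
    rewrite opprB addrC subrK.
    have := nm_distC (E D x') (E D z).
    have := nmD (E D x' - E D z) (E D z); rewrite subrK.
    lra.
have [f fP] := choice (fun pn : X * R * nat => step pn.1 pn.2).
pose s := fix s n := if n is m.+1 then f (s m, m) else (0 : X, 1 : R).
have s0 n : 0 < (s n).2.
  elim: n => [|n IH] /=; first exact: ltr01.
  by have [] := fP (s n, n) IH.
have snest m k z : nm (z - (s (m + k)%N).1) <= (s (m + k)%N).2 ->
    nm (z - (s m).1) <= (s m).2.
  elim: k => [|k IH]; first by rewrite addn0.
  rewrite addnS => h; apply: IH; have [_ _ h3 _] := fP (s (m + k)%N, (m + k)%N) (s0 _).
  exact: h3.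
have sdist m n : (m <= n)%N -> nm ((s n).1 - (s m).1) <= (s m).2.
  move=> mn; apply: (snest _ (n - m)%N); rewrite subnKC// subrr nm0.
  exact: ltW.
have [l sl] : exists l : X, (s n).1 @[n --> \oo] --> l.
  apply: nm_cauchy_cvg => e e0.
  have [N _ hN] : \forall n \near \oo, n.+1%:R^-1 <= e / 2.
    have := @cvg_harmonic R => /cvgrPdist_le /(_ (e / 2) (divr_gt0 e0 (ltr0Sn _ _))).
    by apply: filterS => n; rewrite sub0r normrN; apply: le_trans (ler_norm _).
  exists N.+1 => m n Nm Nn.
  have sN : (s N.+1).2 <= e / 2.
    apply: le_trans (hN _ (leqnn N)).
    by have [_ h2 _ _] := fP (s N, N) (s0 _).
  apply: le_trans (nm_dist _ (s N.+1).1 _) _.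
  rewrite [e]splitr lerD// ?[nm (_ - (s n).1)]nm_distC.
  - exact: le_trans (sdist _ _ Nm) sN.
  - exact: le_trans (sdist _ _ Nn) sN.
have hl n : nm (l - (s n).1) <= (s n).2.
  by apply: nm_cvgn_le sl _; exists n => // k /= nk; apply: sdist.
have [K hK] := spec_pointwise_bounded hE l.
pose N := Num.bound `|K|.
have [_ _ _ [D mD hD]] := fP (s N, N) (s0 _).
have := hD l (hl N.+1).
apply/negP; rewrite -leNgt (le_trans (hK _ mD))// (le_trans (ler_norm _))//.
exact/ltW/archi_boundP.
Qed.

End uniform_bound.

(** * Integrals of simple functions *)

Section simple_functions.
Context {R : realType}.
Implicit Types (s : R[i] -> R[i]) (D : set R[i]).

Lemma borel_set1 (z : R[i]) : borel_set [set z].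
Proof.
apply: borel_closed; apply: accessible_closed_set1.
exact/hausdorff_accessible/norm_hausdorff.
Qed.

Lemma borel_preimage (T : eqType) (r : seq T) (t : R[i] -> T) (Y : set T) :
  (forall z, t z \in r) -> (forall v, borel_set (t @^-1` [set v])) ->
  borel_set (t @^-1` Y).
Proof.
move=> tr mt.
have -> : t @^-1` Y = \bigcup_(v in [set` r] `&` Y) t @^-1` [set v].
  apply/seteqP; split=> z /=; last by case=> v [_ Yv] /= ->.
  by move=> Ytz; exists (t z) => //; split=> //=; exact: tr.
apply: (@fin_bigcup_measurable _ (borelC R)) => [|v _]; last exact: mt.
exact/finite_setIl/finite_seq.
Qed.

Lemma simple_functionP s : simple_function s <->
  (forall z, borel_set (s @^-1` [set z])) /\ finite_set (range s).
Proof.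
split=> -[ms fs]; split=> //.
  move=> z; have := ms measurableT [set z] (borel_set1 z).
  by rewrite setTI.
move=> _ Y mY; rewrite setTI.
have [r rE] := (finite_seqP _).1 fs.
apply: (@borel_preimage _ r) => // z.
have : range s (s z) by exists z.
by rewrite rE.
Qed.

(** Simple functions are handled as functions of a label [t] that takes finitely
    many values, so that several of them can be expressed with one label. *)
Definition partitioned_by (T : eqType) (r : seq T) (t : R[i] -> T) : Prop :=
  [/\ uniq r, forall z, t z \in r & forall v, borel_set (t @^-1` [set v])].

Lemma simple_partitioned s : simple_function s ->
  exists2 r, partitioned_by r s & [set` r] = range s.
Proof.
move=> /simple_functionP[ms /finite_seqP[r rE]].
exists (undup r); last by rewrite rE; apply/seteqP; split=> z /=; rewrite mem_undup.
split=> // [|z]; first exact: undup_uniq.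
have : range s (s z) by exists z.
by rewrite rE mem_undup.
Qed.

Lemma simple_partitioned2 s s' : simple_function s -> simple_function s' ->
  exists r, partitioned_by r (fun z => (s z, s' z)).
Proof.
move=> /simple_partitioned[r [ur sr ms] _] /simple_partitioned[r' [ur' sr' ms'] _].
exists [seq (z, z') | z <- r, z' <- r']; split.
- by apply: allpairs_uniq => // -[? ?] [? ?].
- by move=> z; apply: allpairs_f.
- move=> [v v'].
  have -> : (fun z => (s z, s' z)) @^-1` [set (v, v')] =
      s @^-1` [set v] `&` s' @^-1` [set v'].
    by apply/seteqP; split=> z /= [-> ->].
  exact: borel_setI.
Qed.

Lemma simple_comp (T : eqType) (r : seq T) t (c : T -> R[i]) :
  partitioned_by r t -> simple_function (c \o t).
Proof.
move=> [ur tr mt]; apply/simple_functionP; split.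
  by move=> z; rewrite comp_preimage; apply: borel_preimage tr mt.
apply: (@sub_finite_set _ _ [set` map c r]); last exact: finite_seq.
by move=> _ [z _ <-] /=; apply: map_f.
Qed.

Lemma simple_op2 (g : R[i] -> R[i] -> R[i]) s s' :
  simple_function s -> simple_function s' ->
  simple_function (fun z => g (s z) (s' z)).
Proof.
move=> ss ss'; have [r rP] := simple_partitioned2 ss ss'.
exact: (simple_comp (fun v => g v.1 v.2) rP).
Qed.

Lemma simple_cst (c : R[i]) : simple_function (fun=> c).
Proof.
apply/simple_functionP; split; last exact: finite_image_cst.
by move=> z; rewrite preimage_cst; case: ifP => _; [exact: borel_setT|exact: borel_set0].
Qed.

Lemma indic_partitioned D : borel_set D -> partitioned_by [:: true; false] (fun z => z \in D).
Proof.
move=> mD; split=> // [z|[]]; first by case: (z \in D).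
- suff -> : (fun z => z \in D) @^-1` [set true] = D by [].
  by apply/seteqP; split=> z /= => [/set_mem|/mem_set].
- suff -> : (fun z => z \in D) @^-1` [set false] = ~` D by exact: borel_setC.
  apply/seteqP; split=> z /=; first by move=> h /mem_set; rewrite h.
  by move=> h; apply/negbTE/negP; rewrite inE.
Qed.

Lemma simple_indic D : borel_set D -> simple_function (\1_D : R[i] -> R[i]).
Proof. by move=> mD; apply: (simple_comp (fun b : bool => b%:R) (indic_partitioned mD)). Qed.

End simple_functions.

Section simple_integrals.
Context {R : realType} {X : normedModType R[i]}.
Context (E : set R[i] -> {linear X -> X}) (hE : spectral_measure E).
Implicit Types (s : R[i] -> R[i]) (D : set R[i]) (x : X).

(** Finite additivity. Measurability of the union is part of the induction, as the
    additivity of [E] on two sets presupposes it. *)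
Lemma spec_partition (T : eqType) (r : seq T) t (Q : pred T) x :
  uniq r -> (forall v, borel_set (t @^-1` [set v])) ->
  borel_set [set z | (t z \in r) && Q (t z)] /\
  E [set z | (t z \in r) && Q (t z)] x = \sum_(v <- r | Q v) E (t @^-1` [set v]) x.
Proof.
move=> + mt; elim: r => [_|a r IH /= /andP[ar ur]].
  have -> : [set z | (t z \in [::]) && Q (t z)] = set0.
    by apply/seteqP; split.
  by rewrite big_nil spec0//; split=> //; exact: borel_set0.
have [mr rE] := IH ur.
have [Qa|Qa] := boolP (Q a).
  have -> : [set z | (t z \in a :: r) && Q (t z)] =
      t @^-1` [set a] `|` [set z | (t z \in r) && Q (t z)].
    apply/seteqP; split=> z /=; rewrite in_cons; last first.
      by case=> [->|/andP[-> ->]]; rewrite ?eqxx ?orbT.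
    by move=> /andP[/orP[/eqP->|->] ->]; [left|right].
  split; first exact: borel_setU.
  rewrite specU// ?big_cons ?Qa ?rE//.
  by apply/seteqP; split=> // z /= [->]; rewrite (negbTE ar).
have -> : [set z | (t z \in a :: r) && Q (t z)] =
    [set z | (t z \in r) && Q (t z)].
  apply/seteqP; split=> z /=; rewrite in_cons; last by case/andP=> -> ->; rewrite orbT.
  by case/andP=> /orP[/eqP->|-> ->//]; rewrite (negbTE Qa).
by rewrite big_cons (negbTE Qa).
Qed.

(** Grouping the cells of the label by the value of [c]: this frees the sum from the
    range of the function, which changes under sums and products. *)
Lemma simple_integral_comp (T : eqType) (r : seq T) t (c : T -> R[i]) x :
  partitioned_by r t ->
  simple_integral E (c \o t) x = \sum_(v <- r) c v *: E (t @^-1` [set v]) x.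
Proof.
move=> [ur tr mt].
rewrite /simple_integral (@fsbig_fwiden _ _ _ _ (undup (map c r))); first last.
- move=> z /= [_ nz]; suff -> : (c \o t) @^-1` [set z] = set0 by rewrite spec0 ?scaler0.
  by apply/seteqP; split=> // w /= wz; apply: nz; exists w.
- exact: undup_uniq.
- by move=> _ [z _ <-] /=; rewrite mem_undup map_f.
transitivity (\sum_(z <- undup (map c r))
    \sum_(v <- r | c v == z) c v *: E (t @^-1` [set v]) x).
  apply: eq_bigr => z _.
  rewrite (eq_bigr (fun v => z *: E (t @^-1` [set v]) x)); last by move=> v /eqP->.
  rewrite -scaler_sumr; congr (_ *: _).
  have [_ <-] := spec_partition (fun v => c v == z) x ur mt.
  congr (E _ x); apply/seteqP; split=> w /=; rewrite tr /=; first by move=> ->.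
  by move/eqP.
rewrite (exchange_big_dep xpredT)//=; rewrite big_seq [RHS]big_seq.
apply: eq_bigr => v vr.
rewrite big_mkcond /= (bigD1_seq (c v)) ?undup_uniq ?mem_undup ?map_f//= eqxx.
by rewrite big1 ?addr0// => z /negbTE zc; rewrite eq_sym zc.
Qed.

Lemma simple_integral_op2 (g : R[i] -> R[i] -> R[i]) s s' r x :
  partitioned_by r (fun z => (s z, s' z)) ->
  simple_integral E (fun z => g (s z) (s' z)) x =
  \sum_(v <- r) g v.1 v.2 *: E ((fun z => (s z, s' z)) @^-1` [set v]) x.
Proof. by move=> rP; rewrite -(simple_integral_comp (fun v => g v.1 v.2) x rP). Qed.

Lemma simple_integralD s s' x : simple_function s -> simple_function s' ->
  simple_integral E (fun z => s z + s' z) x = simple_integral E s x + simple_integral E s' x.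
Proof.
move=> ss ss'; have [r rP] := simple_partitioned2 ss ss'.
rewrite (simple_integral_op2 +%R x rP) (simple_integral_op2 (fun a _ => a) x rP).
rewrite (simple_integral_op2 (fun _ a => a) x rP) -big_split /=.
by apply: eq_bigr => v _; rewrite scalerDl.
Qed.

Lemma simple_integralB s s' x : simple_function s -> simple_function s' ->
  simple_integral E (fun z => s z - s' z) x = simple_integral E s x - simple_integral E s' x.
Proof.
move=> ss ss'; have [r rP] := simple_partitioned2 ss ss'.
rewrite (simple_integral_op2 (fun a b => a - b) x rP).
rewrite (simple_integral_op2 (fun a _ => a) x rP).
rewrite (simple_integral_op2 (fun _ a => a) x rP) -sumrB /=.
by apply: eq_bigr => v _; rewrite scalerBl.
Qed.

Lemma simple_integralE s r x : partitioned_by r s ->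
  simple_integral E s x = \sum_(v <- r) v *: E (s @^-1` [set v]) x.
Proof. exact: (simple_integral_comp id). Qed.

Lemma simple_integral_linear s (c : R[i]) x y : simple_function s ->
  simple_integral E s (c *: x + y) = c *: simple_integral E s x + simple_integral E s y.
Proof.
move=> /simple_partitioned[r rP _]; rewrite !(simple_integralE _ rP).
rewrite scaler_sumr -big_split /=; apply: eq_bigr => v _.
by rewrite linearP scalerDr !scalerA mulrC.
Qed.

Lemma simple_integral_cst c x : simple_integral E (fun=> c) x = c *: x.
Proof.
have cP : partitioned_by [:: c] (fun _ : R[i] => c).
  split=> // [z|z]; first by rewrite mem_head.
  by have /simple_functionP[/(_ z)] := simple_cst c.
rewrite (simple_integralE x cP) big_seq1; congr (_ *: _).
rewrite -[RHS](spectral_measureT hE); congr (E _ x).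
by apply/seteqP; split.
Qed.

Lemma simple_integral_indic D x : borel_set D -> simple_integral E (\1_D) x = E D x.
Proof.
move=> mD; rewrite (simple_integral_comp (fun b : bool => b%:R) x (indic_partitioned mD)).
rewrite big_cons big_seq1 scale1r scale0r addr0; congr (E _ x).
by apply/seteqP; split=> z /= => [/set_mem|/mem_set].
Qed.

Lemma simple_integral_specC s D x : simple_function s -> borel_set D ->
  simple_integral E s (E D x) = E D (simple_integral E s x).
Proof.
move=> /simple_partitioned[r rP _] mD; rewrite !(simple_integralE _ rP).
rewrite linear_sum /=; apply: eq_bigr => v _; rewrite linearZ /=.
by rewrite specC//; case: rP.
Qed.

(** Products of distinct cells vanish, so only the diagonal remains. *)
Lemma simple_integralM s s' x : simple_function s -> simple_function s' ->
  simple_integral E (fun z => s z * s' z) x = simple_integral E s (simple_integral E s' x).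
Proof.
move=> ss ss'; have [r rP] := simple_partitioned2 ss ss'.
rewrite (simple_integral_op2 *%R x rP) (simple_integral_op2 (fun _ a => a) x rP).
rewrite (simple_integral_op2 (fun a _ => a) _ rP).
have [ur _ mr] := rP.
rewrite big_seq [RHS]big_seq; apply: eq_bigr => v vr.
rewrite linear_sum (bigD1_seq v)//= [X in _ + X]big1 ?addr0.
  by rewrite linearZ /= spec_id// scalerA.
move=> w wv; rewrite linearZ /= specI//.
suff -> : (fun z => (s z, s' z)) @^-1` [set v] `&` (fun z => (s z, s' z)) @^-1` [set w] = set0.
  by rewrite spec0// scaler0.
by apply/seteqP; split=> // z [/= zv zw]; rewrite -zv -zw eqxx in wv.
Qed.

End simple_integrals.

Section bounded_multipliers.
Context {R : realType} {X : normedModType R[i]}.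

(** The norm is a convex function of each coefficient, so that its maximum over the
    cube [[0, 1]^r] is attained at a vertex, that is, at the sum over a subset. *)
Lemma subset_sum_convex (I : eqType) (r : seq I) (v : I -> X) (c : I -> R) (K : R) w :
  uniq r -> (forall Q : pred I, nm (w + \sum_(i <- r | Q i) v i) <= K) ->
  (forall i, 0 <= c i <= 1) ->
  nm (w + \sum_(i <- r) (c i)%:C *: v i) <= K.
Proof.
move=> + + c01; elim: r w => [|a r IH] w /=.
  by move=> _ /(_ xpredT); rewrite !big_nil.
move=> /andP[ar ur] hK; rewrite big_cons.
have ext (Q : pred I) (b : bool) :
    nm (w + (b%:R *: v a + \sum_(i <- r | Q i) v i)) <= K.
  have := hK (fun i => if i == a then b else Q i).
  rewrite big_cons eqxx.
  have -> : \sum_(i <- r | if i == a then b else Q i) v i = \sum_(i <- r | Q i) v i.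
    rewrite big_seq_cond [RHS]big_seq_cond; apply: eq_bigl => i.
    have [ir|//] := boolP (i \in r); case: eqP => // ia.
    by rewrite -ia ir in ar.
  by case: b => /=; rewrite ?scale1r ?scale0r ?add0r.
have h1 : nm (w + v a + \sum_(i <- r) (c i)%:C *: v i) <= K.
  by apply: IH => // Q; have := ext Q true; rewrite scale1r addrA.
have h0 : nm (w + \sum_(i <- r) (c i)%:C *: v i) <= K.
  by apply: IH => // Q; have := ext Q false; rewrite scale0r add0r.
set S := \sum_(i <- r) _ in h0 h1 *.
have /andP[c0 c1] := c01 a.
have -> : w + ((c a)%:C *: v a + S) =
    (c a)%:C *: (w + v a + S) + (1 - c a)%:C *: (w + S).
  rewrite rmorphB rmorph1 /= scalerBl scale1r [w + v a + S]addrAC scalerDr.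
  by rewrite [RHS]addrC [RHS]addrA subrK addrCA addrC.
apply: le_trans (nmD _ _) _; rewrite !nmZr !ger0_norm ?subr_ge0//.
apply: (@le_trans _ _ (c a * K + (1 - c a) * K)).
  by rewrite lerD// ler_wpM2l// subr_ge0.
by rewrite -mulrDl subrKC mul1r.
Qed.

(** A coefficient in [[- b, b]] is [2 b a - b] with [a] in [[0, 1]]. *)
Lemma subset_sum_real (I : eqType) (r : seq I) (v : I -> X) (c : I -> R) (b K : R) :
  uniq r -> (forall Q : pred I, nm (\sum_(i <- r | Q i) v i) <= K) ->
  0 <= b -> (forall i, `|c i| <= b) ->
  nm (\sum_(i <- r) (c i)%:C *: v i) <= 3 * b * K.
Proof.
move=> ur hK; rewrite le_eqVlt => /predU1P[<-|b0] cb.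
  rewrite big1 ?nm0 ?mulr0 ?mul0r// => i _.
  by have := cb i; rewrite normr_le0 => /eqP ->; rewrite scale0r.
pose a i := (c i + b) / (2 * b).
have a01 i : 0 <= a i <= 1.
  have := cb i; rewrite ler_norml => /andP[? ?]; apply/andP; split.
    by rewrite divr_ge0//; lra.
  by rewrite ler_pdivrMr; lra.
have -> : \sum_(i <- r) (c i)%:C *: v i =
    (2 * b)%:C *: (\sum_(i <- r) (a i)%:C *: v i) - b%:C *: \sum_(i <- r) v i.
  rewrite !scaler_sumr -sumrB; apply: eq_bigr => i _.
  rewrite scalerA -rmorphM /= -scalerBl -rmorphB /=; congr (_%:C *: _).
  by rewrite /a; field; rewrite gt_eqF.
have h1 : nm (\sum_(i <- r) (a i)%:C *: v i) <= K.
  rewrite -[X in nm X]add0r; apply: subset_sum_convex => // Q.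
  by rewrite add0r.
apply: le_trans (nmB _ _) _; rewrite !nmZr !gtr0_norm ?mulr_gt0//.
have -> : 3 * b * K = 2 * b * K + b * K by ring.
by rewrite lerD// ler_wpM2l ?mulr_ge0// ltW.
Qed.

Lemma subset_sum_complex (I : eqType) (r : seq I) (v : I -> X) (c : I -> R[i]) (b K : R) :
  uniq r -> (forall Q : pred I, nm (\sum_(i <- r | Q i) v i) <= K) ->
  0 <= b -> (forall i, normc (c i) <= b) ->
  nm (\sum_(i <- r) c i *: v i) <= 6 * b * K.
Proof.
move=> ur hK b0 cb.
have -> : \sum_(i <- r) c i *: v i =
    \sum_(i <- r) (complex.Re (c i))%:C *: v i +
    'i *: \sum_(i <- r) (complex.Im (c i))%:C *: v i.
  rewrite scaler_sumr -big_split /=; apply: eq_bigr => i _.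
  by rewrite scalerA -scalerDl -complexE.
apply: le_trans (nmD _ _) _; rewrite nmZ.
have -> : normc ('i : R[i]) = 1 by rewrite /= expr0n add0r expr1n sqrtr1.
rewrite mul1r.
have -> : 6 * b * K = 3 * b * K + 3 * b * K by ring.
by apply: lerD; apply: subset_sum_real => // i; apply: le_trans (cb i);
  have [] := normc_ge_ReIm (c i).
Qed.

End bounded_multipliers.

(** On the range of [E D] only the values of [s] on [D] count. As [C] is the same for
    all [D], estimates on bounded parts of the spectrum pass to their union. *)
Definition simple_integral_bound {R : realType} {X : normedModType R[i]}
    (E : set R[i] -> {linear X -> X}) (C : R) : Prop :=
  forall s D (b : R) x, simple_function s -> borel_set D -> 0 <= b ->
    (forall z, D z -> normc (s z) <= b) -> E D x = x ->
    nm (simple_integral E s x) <= C * b * nm x.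

Section simple_bound.
Context {R : realType} {X : completeNormedModType R[i]}.
Context (E : set R[i] -> {linear X -> X}) (hE : spectral_measure E).

(** The sums over subsets of cells are values [E D x], hence of norm at most
    [M * nm x]. *)
Lemma simple_integral_bounded : exists2 C : R, 0 <= C & simple_integral_bound E C.
Proof.
have [M M0 hM] := spec_uniform_bounded hE.
exists (6 * M) => [|s D b x ss mD b0 sb Dx]; first by rewrite mulr_ge0.
pose s' z := s z * (\1_D z : R[i]).
have ss' : simple_function s' by apply: (simple_op2 *%R) => //; exact: simple_indic.
have -> : simple_integral E s x = simple_integral E s' x.
  rewrite (simple_integralM hE) ?simple_integral_indic ?Dx//.
  exact: simple_indic.
have s'b z : normc (s' z) <= b.
  rewrite /s' indicE; have [/set_mem zD|_] := boolP (z \in D).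
    by rewrite mulr1 sb.
  by rewrite mulr0 normc0.
have [r rP rE] := simple_partitioned ss'.
rewrite (simple_integralE hE x rP).
have [ur tr mr] := rP.
have -> : 6 * M * b * nm x = 6 * b * (M * nm x) by ring.
rewrite (eq_big_seq (fun v => (if normc v <= b then v else 0) *: E (s' @^-1` [set v]) x)).
  apply: subset_sum_complex => // [Q|v].
    by have [mQ <-] := spec_partition hE Q x ur mr; apply: hM.
  by case: ifP => // _; rewrite normc0.
move=> v vr; have : range s' v by rewrite -rE.
by move=> [z _ <-]; rewrite s'b.
Qed.

End simple_bound.

(** * Grids, and the complement of the support *)

Section grid.
Context {R : realType}.

Section lipschitz.
Context (l : R[i] -> R) (hl : forall z w, `|l z - l w| <= normc (z - w)).

Lemma borel_lt a : borel_set [set z | l z < a].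
Proof.
apply: borel_open; rewrite openE => z /= lza; apply/nbhs_normc.
exists (a - l z); rewrite ?subr_gt0// => w wz /=.
have := le_trans (ler_norm _) (hl w z).
by move: wz; rewrite ltrBrDl; lra.
Qed.

Lemma borel_ge a : borel_set [set z | a <= l z].
Proof.
suff -> : [set z | a <= l z] = ~` [set z | l z < a] by (apply: borel_setC; exact: borel_lt).
by apply/seteqP; split=> z /=; rewrite leNgt => /negP.
Qed.

Definition grid_index (k : nat) z : int := Num.floor (k.+1%:R * l z).

Lemma grid_index_itv k z : (grid_index k z)%:~R / k.+1%:R <= l z <
  (grid_index k z)%:~R / k.+1%:R + k.+1%:R^-1.
Proof.
have := floor_itv (k.+1%:R * l z); rewrite /grid_index.
set j := Num.floor _; rewrite rmorphD /= => /andP[h1 h2].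
rewrite ler_pdivrMr ?ltr0Sn// mulrC h1 /=.
by rewrite -[X in _ + X]mul1r -mulrDl ltr_pdivlMr ?ltr0Sn// mulrC.
Qed.

Lemma borel_grid k j : borel_set [set z | grid_index k z = j].
Proof.
suff -> : [set z | grid_index k z = j] =
    [set z | j%:~R / k.+1%:R <= l z] `&` [set z | l z < j%:~R / k.+1%:R + k.+1%:R^-1].
  by apply: borel_setI; [exact: borel_ge|exact: borel_lt].
apply/seteqP; split=> z /=.
  by move=> <-; have /andP[] := grid_index_itv k z.
move=> [h1 h2]; apply/floor_def.
rewrite ler_pdivrMr ?ltr0Sn// in h1.
rewrite -[X in _ + X]mul1r -mulrDl ltr_pdivlMr ?ltr0Sn// in h2.
by rewrite rmorphD /= mulrC h1.
Qed.

Lemma grid_index_same k z w : grid_index k z = grid_index k w -> `|l z - l w| <= k.+1%:R^-1.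
Proof.
move=> zw; have := grid_index_itv k z; rewrite zw => /andP[h1 h2].
have /andP[h3 h4] := grid_index_itv k w; move: h1 h2 h3 h4.
set q := _ / _; set p := _^-1 => h1 h2 h3 h4.
by rewrite ler_norml; apply/andP; split; lra.
Qed.

(** The function is cut off outside [S], where [l] may be unbounded, to keep the
    set of its values finite. *)
Lemma simple_grid (S : set R[i]) (N : R) k : borel_set S ->
  (forall z, S z -> `|l z| <= N) ->
  simple_function (fun z => ((if z \in S then grid_index k z else 0)%:~R / k.+1%:R)%:C).
Proof.
move=> mS SN.
pose t z : int := if z \in S then grid_index k z else 0.
pose B := Num.bound (k.+1%:R * N + 1).
have tB z : (`|t z| <= B)%N.
  rewrite /t; have [/set_mem zS|_ //] := boolP (z \in S).
  have /andP[h1 h2] := floor_itv (k.+1%:R * l z).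
  have hB : k.+1%:R * N + 1 < B%:R.
    apply: archi_boundP; rewrite addr_ge0// mulr_ge0//.
    exact: le_trans (normr_ge0 _) (SN _ zS).
  have lN : `|k.+1%:R * l z| <= k.+1%:R * N.
    by rewrite normrM ger0_norm// ler_wpM2l// SN.
  rewrite -(ler_nat R) natr_absz.
  rewrite -/(grid_index k z) in h1 h2 *.
  rewrite intr_norm; move: h1 h2 lN; rewrite rmorphD /= !ler_norml.
  by move=> h1 h2 /andP[h3 h4]; apply/andP; split; lra.
pose r := undup ([seq m%:Z | m <- iota 0 B.+1] ++ [seq - m%:Z | m <- iota 0 B.+1]).
apply: (@simple_comp _ _ r t (fun j => (j%:~R / k.+1%:R)%:C)); split.
- exact: undup_uniq.
- move=> z; rewrite mem_undup mem_cat; have := tB z.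
  case: (t z) => m mB; apply/orP; [left|right].
    by apply: (map_f (fun m : nat => m%:Z)); rewrite mem_iota.
  by rewrite NegzE; apply: (map_f (fun m : nat => - m%:Z)); rewrite mem_iota.
- move=> j.
  have -> : t @^-1` [set j] =
      (S `&` [set z | grid_index k z = j]) `|` (~` S `&` [set z | 0 = j]).
    apply/seteqP; split=> z /=; rewrite /t.
      have [/set_mem zS tz|zS tz] := boolP (z \in S); first by left.
      by right; split=> // /mem_set; apply/negP.
    by move=> [[/mem_set ->]//|[zS <-]]; rewrite memNset.
  apply: borel_setU; apply: borel_setI => //; first exact: borel_grid.
    exact: borel_setC.
  have [->|j0] := eqVneq 0 j.
    by rewrite (_ : [set _ | _] = setT); [exact: borel_setT|apply/seteqP; split].
  rewrite (_ : [set _ | _] = set0); first exact: borel_set0.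
  by apply/seteqP; split=> // z /= j0'; rewrite j0' eqxx in j0.
Qed.

End lipschitz.

Lemma borel_Re_le (a : R) : borel_set [set z : R[i] | complex.Re z <= a].
Proof.
rewrite (_ : [set _ | _] = [set z | - a <= - complex.Re z]).
  by apply: borel_ge => z w; rewrite -opprD normrN Re_dist.
by apply/seteqP; split=> z /=; rewrite lerN2.
Qed.

Lemma borel_normc_le (a : R) : borel_set [set z : R[i] | normc z <= a].
Proof.
rewrite (_ : [set _ | _] = [set z | - a <= - normc z]).
  by apply: borel_ge => z w; rewrite -opprD normrN normc_dist.
by apply/seteqP; split=> z /=; rewrite lerN2.
Qed.

Definition grid_cell (c : nat * int * int) : set R[i] :=
  [set z | grid_index (@complex.Re R) c.1.1 z = c.1.2] `&`
  [set z | grid_index (@complex.Im R) c.1.1 z = c.2].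

Lemma borel_grid_cell c : borel_set (grid_cell c).
Proof. by apply: borel_setI; apply: borel_grid; [exact: Re_dist|exact: Im_dist]. Qed.

Lemma grid_cell_diam c z w : grid_cell c z -> grid_cell c w ->
  normc (z - w) <= 2 / c.1.1.+1%:R.
Proof.
move=> [/= z1 z2] [/= w1 w2]; apply: le_trans (normc_le_ReIm _) _.
have -> : complex.Re (z - w) = complex.Re z - complex.Re w by case: z {z1 z2}; case: w {w1 w2}.
have -> : complex.Im (z - w) = complex.Im z - complex.Im w by case: z {z1 z2}; case: w {w1 w2}.
rewrite mulr_natl mulr2n lerD// ; apply: grid_index_same.
  by rewrite z1.
by rewrite z2.
Qed.

Lemma inv_nat_lt (e : R) : 0 < e -> exists N, forall n, (N <= n)%N -> n.+1%:R^-1 < e.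
Proof.
move=> e0; have := @cvg_harmonic R => /cvgrPdist_lt /(_ e e0)[N _ hN].
exists N => n Nn; have := hN n Nn; rewrite /= sub0r normrN.
by apply: le_lt_trans; exact: ler_norm.
Qed.

(** The function [s k] takes at [z] the value of the lower left corner of its grid
    square; real and imaginary parts are both off by at most the mesh. *)
Lemma grid_approx (S : set R[i]) (N : R) : borel_set S ->
  (forall z, S z -> normc z <= N) ->
  exists s : nat -> R[i] -> R[i], (forall k, simple_function (s k)) /\
    forall e : R, 0 < e -> exists K, forall k, (K <= k)%N ->
      forall z, normc (s k z - z * \1_S z) <= e.
Proof.
move=> mS SN.
pose s1 l k z : R[i] := ((if z \in S then grid_index l k z else 0)%:~R / k.+1%:R)%:C.
pose s k z := s1 (@complex.Re R) k z + 'i * s1 (@complex.Im R) k z.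
exists s; split=> [k|e e0].
  apply: (simple_op2 (fun a b => a + 'i * b)).
    apply: (simple_grid Re_dist k mS (N := N)) => z zS.
    by have [h _] := normc_ge_ReIm z; exact: le_trans h (SN _ zS).
  apply: (simple_grid Im_dist k mS (N := N)) => z zS.
  by have [_ h] := normc_ge_ReIm z; exact: le_trans h (SN _ zS).
have [K hK] := inv_nat_lt (divr_gt0 e0 (ltr0Sn R 1)).
exists K => k Kk z; have {}hK := hK _ Kk.
rewrite /s /s1 indicE; have [zS|zS] := boolP (z \in S); last first.
  by rewrite mulr0n mul0r rmorph0 mulr0 addr0 mulr0 subr0 normc0 ltW.
rewrite mulr1; apply: le_trans (normc_le_ReIm _) _.
have := grid_index_itv (@complex.Re R) k z; have := grid_index_itv (@complex.Im R) k z.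
set b := _ / _; set a := _ / _; move: hK; set p := _^-1 => hK.
clearbody a b p; case: z {zS} => x y /=.
rewrite !mul0r !mul1r !(sub0r,addr0,add0r,mulr0,subr0,oppr0) => /andP[h1 h2] /andP[h3 h4].
rewrite [e]splitr lerD// ler_norml; apply/andP; split; lra.
Qed.

End grid.

Section null_complement.
Context {R : realType} {X : normedModType R[i]}.
Context (E : set R[i] -> {linear X -> X}) (hE : spectral_measure E).

Lemma support_compl z : ~ spectral_support E z ->
  exists U : set R[i]^o, [/\ open U, U z & forall x, E U x = 0].
Proof.
move=> /existsNP[U /not_implyP[oU /not_implyP[Uz hU]]].
exists U; split=> // x; apply: contrapT => /eqP Ux.
by apply: hU; exists x.
Qed.

Lemma borel_support : borel_set (spectral_support E).
Proof.
rewrite -(setCK (spectral_support E)); apply: borel_setC; apply: borel_open.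
rewrite openE => z /support_compl[U [oU Uz U0]].
rewrite /interior; have : nbhs (z : R[i]^o) U by apply: open_nbhs_nbhs.
apply: filterS => w Uw /(_ U oU Uw)[x]; by rewrite U0 eqxx.
Qed.

(** A point outside the support has a null neighbourhood, which contains the square
    of a fine enough grid around it. There are countably many squares in all, so those
    that are null cover the complement of the support and have a null union. *)
Lemma spec_support_compl x : E (~` spectral_support E) x = 0.
Proof.
pose null (c : nat * int * int) := forall x, E (grid_cell c) x = 0.
pose D n : set R[i] := if unpickle n is Some c then
  (if `[< null c >] then grid_cell c else set0) else set0.
have mD n : borel_set (D n).
  rewrite /D; case: unpickle => [c|]; last exact: borel_set0.
  by case: ifP => _; [exact: borel_grid_cell|exact: borel_set0].
have D0 n y : E (D n) y = 0.
  rewrite /D; case: unpickle => [c|]; last by rewrite spec0.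
  by case: ifP => [/asboolP->|_]//; rewrite spec0.
have := spec_null_bigcup hE mD D0 x => D0x.
have mS := borel_setC borel_support.
rewrite -(spec_sub hE x mS (borel_bigcup mD)) ?D0x ?linear0// => z.
move=> /support_compl[U [oU Uz U0]].
have [e e0 eU] := (nbhs_normc z U).1 (open_nbhs_nbhs (conj oU Uz)).
have [K hK] := inv_nat_lt (divr_gt0 e0 (ltr0Sn R 1)).
pose c : nat * int * int :=
  (K, grid_index (@complex.Re R) K z, grid_index (@complex.Im R) K z).
exists (pickle c) => //=; rewrite /D pickleK.
have cz : grid_cell c z by split.
suff /asboolP -> : null c by [].
move=> y; rewrite -(spec_sub hE y (borel_grid_cell c) (borel_open oU)) ?U0 ?linear0//.
move=> w cw; apply: eU; apply: le_lt_trans (grid_cell_diam cw cz) _.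
by rewrite mulrC -ltr_pdivlMr// hK.
Qed.

Lemma spec_support_setI D x : borel_set D -> E (D `&` spectral_support E) x = E D x.
Proof.
move=> mD; rewrite [RHS](spec_setID hE x mD borel_support) setDE.
rewrite -[X in _ = _ + X](specI hE)//; last exact: (borel_setC borel_support).
by rewrite spec_support_compl linear0 addr0.
Qed.

End null_complement.

(** * Simple approximations of a scalar type operator *)

Section bounded_integrals.
Context {R : realType} {X : completeNormedModType R[i]}.
Context (E : set R[i] -> {linear X -> X}) (hE : spectral_measure E).
Implicit Types (F : R[i] -> R[i]).

(** Uniformly convergent simple functions have integrals that are Cauchy in operator
    norm. The hypothesis makes [F] bounded and Borel, so that the default value in the
    definition of the integral does not occur. *)
Lemma bounded_integralP F (s : nat -> R[i] -> R[i]) :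
  (forall k, simple_function (s k)) ->
  (forall e : R, 0 < e -> exists K, forall k, (K <= k)%N ->
     forall z, normc (s k z - F z) <= e) ->
  is_bounded_integral E F (bounded_integral E F).
Proof.
move=> ss sF; apply: getPex.
have [C C0 hC] := simple_integral_bounded hE.
have cauchy_s (e : R) : 0 < e -> exists K, forall k m, (K <= k)%N -> (K <= m)%N ->
    forall x, nm (simple_integral E (s k) x - simple_integral E (s m) x) <= e * nm x.
  move=> e0; have C1 : 0 < C + 1 by rewrite ltr_wpDl.
  have d0 : 0 < e / (C + 1) / 2 by rewrite !divr_gt0.
  have [K hK] := sF _ d0; exists K => k m Kk Km x.
  rewrite -(simple_integralB hE)//.
  have -> : e * nm x = (C + 1) * (e / (C + 1)) * nm x.
    by congr (_ * _); field; rewrite gt_eqF.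
  apply: le_trans (hC _ setT (e / (C + 1)) _ _ _ _ _ _) _ => //.
  - exact: (simple_op2 (fun a b => a - b)).
  - exact: borel_setT.
  - by rewrite divr_ge0// ltW.
  - move=> z _; rewrite [leRHS]splitr.
    have -> : s k z - s m z = (s k z - F z) + (- (s m z - F z)) by ring.
    by apply: le_trans (normc_triangle _ _) _; rewrite normc_opp lerD ?hK.
  - by rewrite (spectral_measureT hE).
  - by rewrite ler_wpM2r ?nm_ge0// ler_wpM2r ?lerDl// divr_ge0// ltW.
have ex_lim x : exists l : X, simple_integral E (s k) x @[k --> \oo] --> l.
  apply: nm_cauchy_cvg => e e0.
  have x1 : 0 < nm x + 1 by rewrite ltr_wpDl// nm_ge0.
  have [K hK] := cauchy_s _ (divr_gt0 e0 x1); exists K => m n Km Kn.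
  apply: le_trans (hK _ _ Km Kn x) _.
  by rewrite mulrAC ler_pdivrMr// ler_wpM2l ?lerDl// ltW.
have [T hT] := choice ex_lim.
exists T, s; split=> // e e0; have [r r0 ->] := gt0_complexP e0.
  have [K hK] := sF _ r0; exists K => // k /= Kk z.
  by rewrite normE lecR hK.
have [K hK] := cauchy_s _ r0; exists K => // k /= Kk x.
rewrite !nmE -rmorphM lecR /= nm_distC.
apply: nm_cvgn_le (hT x) _; exists K => // m /= Km.
by rewrite hK.
Qed.

Lemma bounded_integral_approx F T : is_bounded_integral E F T ->
  forall e : R, 0 < e -> exists s, [/\ simple_function s,
    forall z, normc (s z - F z) <= e
    & forall x, nm (simple_integral E s x - T x) <= e * nm x].
Proof.
move=> [s [ss sF sT]] e e0; have ec0 : 0 < e%:C by rewrite ltcR.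
have [N _ hN] := filterI (sF _ ec0) (sT _ ec0).
have [/= h1 h2] := hN N (leqnn N); exists (s N); split=> // [z|x].
  by have := h1 z; rewrite normE lecR.
by have := h2 x; rewrite !nmE -rmorphM lecR.
Qed.

End bounded_integrals.

Section scalar_type.
Context {R : realType} {X : completeNormedModType R[i]}.
Context (A : partial_op X) (E : set R[i] -> {linear X -> X}).
Context (hA : scalar_type_spectral A E).
Implicit Types (D : set R[i]) (x : X).

Let hE : spectral_measure E. Proof. by case: hA. Qed.
Let sigma := spectrum A.

Lemma borel_spectrum : borel_set sigma.
Proof. by rewrite /sigma; case: hA => _ _ <- _; exact: borel_support. Qed.

Lemma spec_spectrum D x : borel_set D -> E (D `&` sigma) x = E D x.
Proof.
by case: hA => _ _ h _ mD; rewrite /sigma -h (spec_support_setI hE).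
Qed.

Let T n : X -> X := bounded_integral E (truncation sigma id n).

Lemma truncationE n z :
  truncation sigma id n z = z * \1_(sigma `&` [set w | normc w <= n%:R]) z.
Proof.
rewrite /truncation; congr (_ * \1_ _ z); apply/seteqP.
have nC w : (`|w : R[i]| <= n%:R) = (normc w <= n%:R).
  by rewrite normE -lecR rmorph_nat.
by split=> w /= [sw]; rewrite nC.
Qed.

Lemma truncation_approx n (e : R) : 0 < e -> exists s, [/\ simple_function s,
    forall z, normc (s z - truncation sigma id n z) <= e
    & forall x, nm (simple_integral E s x - T n x) <= e * nm x].
Proof.
apply: (bounded_integral_approx (F := truncation sigma id n)).
have mS : borel_set (sigma `&` [set w | normc w <= n%:R]).
  by apply: borel_setI; [exact: borel_spectrum|exact: borel_normc_le].
have [s [ss hs]] := grid_approx (N := n%:R) mS (fun z => @proj2 _ _).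
apply: (bounded_integralP hE ss) => r r0; have [K hK] := hs r r0.
by exists K => k Kk z; rewrite truncationE hK.
Qed.

Lemma dom_cvg x : dom A x -> T n x @[n --> \oo] --> A x.
Proof.
case: hA => _ _ _ [domE appE] Ax; rewrite (appE _ Ax).
by move: Ax; rewrite domE.
Qed.

Lemma cvg_dom x l : T n x @[n --> \oo] --> l -> dom A x /\ A x = l.
Proof.
case: hA => _ _ _ [domE appE] Tl.
have Ax : dom A x by rewrite domE /=; apply/cvg_ex; exists l.
by split=> //; rewrite (appE _ Ax); apply: cvg_lim Tl; exact: norm_hausdorff.
Qed.

Lemma dom_linear (c : R[i]) x y : dom A x -> dom A y ->
  dom A (c *: x + y) /\ A (c *: x + y) = c *: A x + A y.
Proof. by case: hA => -[[_ h] _] _ _ _; apply: h. Qed.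

Lemma domB x y : dom A x -> dom A y -> dom A (x - y) /\ A (x - y) = A x - A y.
Proof.
move=> Ax Ay; have [] := dom_linear (-1) Ay Ax.
by rewrite !scaleN1r ![- _ + _]addrC.
Qed.

Lemma trunc_specC n D x : borel_set D -> T n (E D x) = E D (T n x).
Proof.
move=> mD; have [M M0 hM] := spec_uniform_bounded hE.
have K0 : 0 < 2 * M * nm x + 1 by rewrite ltr_wpDl// !mulr_ge0// nm_ge0.
apply/eqP; rewrite -subr_eq0; apply/eqP/le0_nm_eq0 => e e0.
have [s [ss _ sT]] := truncation_approx n (divr_gt0 e0 K0).
apply: le_trans (nm_dist _ (simple_integral E s (E D x)) _) _.
rewrite nm_distC {2}(simple_integral_specC hE)// -linearB.
have h1 := sT (E D x).
have h2 := le_trans (hM D (simple_integral E s x - T n x) mD) (ler_wpM2l M0 (sT x)).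
have h3 := ler_wpM2l (ltW (divr_gt0 e0 K0)) (hM D x mD).
have : 2 * M * nm x * (e / (2 * M * nm x + 1)) <= e.
  by rewrite mulrC mulrAC ler_pdivrMr// ler_wpM2l ?lerDl// ltW.
set p := e / _ in h1 h2 h3 *; lra.
Qed.

(** Each truncated integral commutes with [E D], and [E D] is continuous, so that
    the defining limit of [A (E D x)] is the image of that of [A x]. *)
Lemma dom_spec D x : borel_set D -> dom A x -> dom A (E D x) /\ A (E D x) = E D (A x).
Proof.
move=> mD Ax; apply: cvg_dom.
have [M M0 hM] := spec_uniform_bounded hE.
rewrite (_ : (fun n => _) = (fun n => E D (T n x))).
  exact: (nm_bounded_cvg (fun x => hM D x mD) (dom_cvg Ax)).
by apply/funext => n; rewrite trunc_specC.
Qed.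

(** The truncations of the identity at levels beyond the bound of [D] agree on [D], so
    that on the range of [E D] the limit that defines [A] is stationary, and the
    functions that approximate a truncation serve for [A]. *)
Lemma app_approx D (N : R) (e : R) : borel_set D -> D `<=` sigma ->
  (forall z, D z -> normc z <= N) -> 0 < e ->
  exists s, [/\ simple_function s, forall z, D z -> normc (s z - z) <= e
    & forall x, E D x = x -> dom A x /\ nm (A x - simple_integral E s x) <= e * nm x].
Proof.
move=> mD Ds DN e0; have [C C0 hC] := simple_integral_bounded hE.
pose n := Num.bound `|N|.
have Dn z : D z -> normc z <= n%:R.
  move=> /DN/le_trans; apply; rewrite (le_trans (ler_norm _))//.
  exact/ltW/archi_boundP.
have truncD m z : (n <= m)%N -> D z -> truncation sigma id m z = z.
  move=> nm_ Dz; rewrite truncationE indicE mem_set ?mulr1//; split; first exact: Ds.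
  by apply: le_trans (Dn _ Dz) _; rewrite ler_nat.
have [s [ss sF sT]] := truncation_approx n e0.
exists s; split=> // [z Dz|x Dx].
  by have := sF z; rewrite truncD.
suff /cvg_dom [Ax ->] : T m x @[m --> \oo] --> T n x by rewrite nm_distC sT.
apply/nm_cvgP => d d0; exists n => // m /= nlem.
have K0 : 0 < 2 * (C + 1) * nm x + 1 by rewrite ltr_wpDl// !mulr_ge0 ?addr_ge0// nm_ge0.
have p0 := divr_gt0 d0 K0; set p := d / _ in p0.
have [s1 [ss1 sF1 sT1]] := truncation_approx n p0.
have [s2 [ss2 sF2 sT2]] := truncation_approx m p0.
have h : nm (simple_integral E s1 x - simple_integral E s2 x) <= C * (p + p) * nm x.
  rewrite -(simple_integralB hE)//; apply: (hC _ D) => //.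
  - exact: (simple_op2 (fun a b => a - b)).
  - by rewrite addr_ge0// ltW.
  - move=> z Dz; have := sF1 z; have := sF2 z; rewrite !truncD// => h2 h1.
    have -> : s1 z - s2 z = (s1 z - z) + (- (s2 z - z)) by ring.
    by apply: le_trans (normc_triangle _ _) _; rewrite normc_opp lerD.
have h1 := sT1 x; have := sT2 x; rewrite nm_distC => h2.
have h3 := nm_dist (T m x) (simple_integral E s2 x) (simple_integral E s1 x).
have h4 := nm_dist (T m x) (simple_integral E s1 x) (T n x).
rewrite nm_distC in h.
have : (2 * (C + 1) * nm x) * p <= d.
  by rewrite /p mulrC mulrAC ler_pdivrMr// ler_wpM2l ?lerDl// ltW.
lra.
Qed.

(** On the range of [E D] the operator [A] is within [1] of a bounded one. *)
Lemma app_bounded D (N : R) : borel_set D -> D `<=` sigma ->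
  (forall z, D z -> normc z <= N) ->
  exists2 K : R, 0 <= K & forall x, E D x = x -> dom A x /\ nm (A x) <= K * nm x.
Proof.
move=> mD Ds DN; have [C C0 hC] := simple_integral_bounded hE.
have [s [ss sD sA]] := app_approx mD Ds DN ltr01.
exists (C * (`|N| + 1) + 1) => [|x Dx].
  by rewrite addr_ge0// mulr_ge0// addr_ge0.
have [Ax hx] := sA x Dx; split=> //.
rewrite -[A x](subrK (simple_integral E s x)).
apply: le_trans (nmD _ _) _; rewrite mulrDl addrC lerD//.
apply: (hC _ D) => //.
move=> z Dz; rewrite -[s z](subrK z) addrC.
apply: le_trans (normc_triangle _ _) _; rewrite lerD ?sD//.
exact: le_trans (DN _ Dz) (ler_norm _).
Qed.

(** On the range of [E [set 0]] the simple approximations of [A] are as small as their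
    values at [0]. *)
Lemma app_spec0 x : dom A (E [set 0] x) /\ A (E [set 0] x) = 0.
Proof.
have [C C0 hC] := simple_integral_bounded hE.
pose D : set R[i] := [set 0] `&` sigma.
have mD : borel_set D by apply: borel_setI; [exact: borel_set1|exact: borel_spectrum].
rewrite -(spec_spectrum x (borel_set1 0)) -/D; set u := E D x.
have Du : E D u = u by rewrite /u spec_id.
have Ds : D `<=` sigma by exact: subIsetr.
have D0 z : D z -> normc z <= 0 by move=> [-> _]; rewrite normc0.
have [Au _] : dom A u /\ True.
  by have [s [_ _ /(_ u Du)[]]] := app_approx mD Ds D0 ltr01.
split=> //; apply: le0_nm_eq0 => e e0.
have K0 : 0 < (C + 1) * nm u + 1 by rewrite ltr_wpDl// mulr_ge0 ?addr_ge0// nm_ge0.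
have p0 := divr_gt0 e0 K0; set p := e / _ in p0.
have [s [ss sD /(_ u Du)[_ h1]]] := app_approx mD Ds D0 p0.
have h2 : nm (simple_integral E s u) <= C * p * nm u.
  apply: (hC _ D) => //; first exact: ltW.
  by move=> z Dz; have := sD z Dz; case: Dz => -> _; rewrite subr0.
have := nmD (A u - simple_integral E s u) (simple_integral E s u); rewrite subrK.
have : ((C + 1) * nm u) * p <= e.
  by rewrite /p mulrC mulrAC ler_pdivrMr// ler_wpM2l ?lerDl// ltW.
lra.
Qed.

Section away_from_zero.
Context (D : set R[i]) (N d : R).
Context (mD : borel_set D) (Ds : D `<=` sigma).
Context (DN : forall z, D z -> normc z <= N).
Context (d0 : 0 < d) (dD : forall z, D z -> d <= normc z).

(** The reciprocal of a simple approximation of the identity on [D] inverts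
    [A] up to a small error. *)
Lemma approx_inverse : exists2 K : R, 0 <= K & forall e : R, 0 < e ->
  exists s s' : R[i] -> R[i], [/\ simple_function s, simple_function s',
    (forall x, E D x = x -> dom A x /\ nm (A x - simple_integral E s x) <= e * nm x),
    (forall x, E D x = x -> nm (simple_integral E s' x) <= K * nm x)
    & forall x, E D x = x -> simple_integral E s' (simple_integral E s x) = x /\
        simple_integral E s (simple_integral E s' x) = x].
Proof.
have [C C0 hC] := simple_integral_bounded hE.
exists (C * (2 / d)) => [|e e0]; first by rewrite mulr_ge0// divr_ge0// ltW.
(* an error of at most [d / 2] keeps the values away from [0] on [D] *)
have m0 : 0 < Num.min e (d / 2) by rewrite lt_min e0 divr_gt0.
have [s [ss sD sA]] := app_approx mD Ds DN m0.
have sd z : D z -> d / 2 <= normc (s z).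
  move=> Dz; have := le_trans (sD z Dz) (_ : _ <= d / 2).
  rewrite ge_min lexx orbT => /(_ isT) h.
  have := normc_triangle (s z) (- (s z - z)).
  have -> : s z + - (s z - z) = z by ring.
  by rewrite normc_opp; have := dD Dz; lra.
have s0 z : D z -> s z != 0.
  by move=> /sd; apply: contraTneq => ->; rewrite normc0 -ltNge divr_gt0.
have ss' : simple_function (fun z => (s z)^-1) by exact: (simple_op2 (fun a _ => a^-1) ss ss).
exists s, (fun z => (s z)^-1); split=> // [x Dx|x Dx|x Dx].
- have [Ax h] := sA x Dx; split=> //; apply: le_trans h _.
  by rewrite ler_wpM2r ?nm_ge0// ge_min lexx.
- apply: (hC _ D) => //; first by rewrite divr_ge0// ltW.
  move=> z Dz; rewrite normcV -(invf_div d 2) lef_pV2 ?sd// posrE ?divr_gt0//.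
  by apply: lt_le_trans (sd z Dz); rewrite divr_gt0.
have inv1 g : simple_function g -> (forall z, D z -> g z = 1) -> simple_integral E g x = x.
  move=> sg g1; apply/eqP; rewrite -subr_eq0; apply/eqP/nm_eq0/eqP.
  rewrite eq_le nm_ge0 andbT -{2}[x]scale1r -(simple_integral_cst hE 1 x).
  rewrite -(simple_integralB hE)//; last exact: simple_cst.
  have -> : 0 = C * 0 * nm x by rewrite mulr0 mul0r.
  apply: (hC _ D) => //.
    by apply: (simple_op2 (fun a b => a - b)) => //; exact: simple_cst.
  by move=> z Dz; rewrite g1// subrr normc0.
rewrite -!(simple_integralM hE)//; split; apply: inv1.
- exact: (simple_op2 *%R ss' ss).
- by move=> z Dz; rewrite mulVf// s0.
- exact: (simple_op2 *%R ss ss').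
- by move=> z Dz; rewrite mulfV// s0.
Qed.

(** The approximate inverse of [A] is bounded, and its error is absorbed. *)
Lemma app_bounded_below : exists2 K : R, 0 <= K &
  forall x, E D x = x -> nm x <= K * nm (A x).
Proof.
have [K K0 hK] := approx_inverse.
exists (2 * K) => [|x Dx]; first by rewrite mulr_ge0.
have K1 : 0 < 2 * (K + 1) by rewrite mulr_gt0// ltr_wpDl.
have [s [s' [ss ss' sA s'K /(_ x Dx)[sK _]]]] := hK _ (divr_gt0 ltr01 K1).
have [_ h1] := sA x Dx.
have h2 : nm x <= K * nm (simple_integral E s x).
  by rewrite -{1}sK; apply: s'K; rewrite -(simple_integral_specC hE)// Dx.
have h3 : nm (simple_integral E s x) <= nm (A x) + 1 / (2 * (K + 1)) * nm x.
  rewrite -[simple_integral E s x](subKr (A x)).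
  by apply: le_trans (nmB _ _) _; rewrite lerD2l.
have h4 := le_trans h2 (ler_wpM2l K0 h3).
have h5 : K * (1 / (2 * (K + 1)) * nm x) <= nm x / 2.
  rewrite mulrA [leRHS]mulrC ler_wpM2r ?nm_ge0// mulrA mulr1 ler_pdivrMr// mulrA.
  by rewrite mulVf ?pnatr_eq0// mul1r lerDl.
lra.
Qed.

(** With [s] close to the identity on [D], the vector [x] is approximated by the value
    of [A] at the integral of [1 / s] applied to [x]. *)
Lemma range_dense x : E D x = x -> closure (op_range A) x.
Proof.
move=> Dx U; rewrite -nbhs_ballE => -[e /= e0 eU].
have [r r0 re] := gt0_complexP e0.
have [K K0 hK] := approx_inverse.
have K1 : 0 < K * nm x + 1 by rewrite ltr_wpDl// mulr_ge0// nm_ge0.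
have [s [s' [ss ss' sA s'K /(_ x Dx)[_ sK]]]] := hK _ (divr_gt0 r0 K1).
pose u := simple_integral E s' x.
have Du : E D u = u by rewrite -(simple_integral_specC hE)// Dx.
have [Au h] := sA u Du; exists (A u); split; first by exists u.
apply: eU; rewrite -ball_normE /ball_ /= nmE re ltcR nm_distC.
rewrite sK in h; apply: le_lt_trans h _.
rewrite mulrAC ltr_pdivrMr// ltr_pM2l//.
by rewrite (le_lt_trans (s'K x Dx))// ltrDl.
Qed.

End away_from_zero.

End scalar_type.

(** * Riemann integrals of continuous vector functions *)

Section partitions.
Context {R : realType}.
Implicit Types (a b : R) (x xi : nat -> R).

Lemma tagged_partition_homo a b n x xi : tagged_partition a b n x xi ->
  forall j k, (j <= k)%N -> (k <= n)%N -> x j <= x k.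
Proof.
move=> [_ _ hx] j k; elim: k => [|k IH]; first by rewrite leqn0 => /eqP->.
rewrite leq_eqVlt => /predU1P[->//|]; rewrite ltnS => jk kn.
have /andP[h1 h2] := hx k kn.
exact: le_trans (IH jk (ltnW kn)) (le_trans h1 h2).
Qed.

Lemma tagged_partition_itv a b n x xi : tagged_partition a b n x xi ->
  forall k, (k <= n)%N -> a <= x k <= b.
Proof.
move=> h k kn; have hx := tagged_partition_homo h; have [<- <- _] := h.
by rewrite !hx.
Qed.

Definition uniform_partition a b (n k : nat) : R := a + k%:R * ((b - a) / n.+1%:R).

Lemma uniform_partitionS a b n k :
  uniform_partition a b n k.+1 - uniform_partition a b n k = (b - a) / n.+1%:R.
Proof. by rewrite /uniform_partition -natr1; ring. Qed.

Lemma uniform_partition_tagged a b n : a <= b ->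
  tagged_partition a b n.+1 (uniform_partition a b n) (uniform_partition a b n).
Proof.
move=> ab; split.
- by rewrite /uniform_partition mul0r addr0.
- by rewrite /uniform_partition mulrC divfK ?pnatr_eq0// addrC subrK.
- move=> k _; rewrite lexx /= -subr_ge0 uniform_partitionS.
  by rewrite divr_ge0// subr_ge0.
Qed.

Lemma fine_uniform_partition a b (d : R) : 0 < d -> exists n,
  forall k, uniform_partition a b n k.+1 - uniform_partition a b n k < d.
Proof.
move=> d0; exists (Num.bound `|(b - a) / d|) => k; rewrite uniform_partitionS.
rewrite ltr_pdivrMr// mulrC -ltr_pdivrMr//.
apply: le_lt_trans (ler_norm _) _; apply: lt_le_trans (archi_boundP (normr_ge0 _)) _.
by rewrite ler_nat.
Qed.

(** For [a <= b] and [p <= q] this is the length of the intersection of the intervals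
    with end points [a, b] and [p, q]. *)
Definition overlap a b p q : R :=
  Num.min b q - Num.min b p - (Num.min a q - Num.min a p).

Lemma overlap_ge0 a b p q : a <= b -> p <= q -> 0 <= overlap a b p q.
Proof.
move=> ab pq; rewrite /overlap subr_ge0.
case: (leP a p) => ap.
  by rewrite (min_l (le_trans ap pq)) subrr subr_ge0 le_min !ge_min lexx pq orbT.
rewrite (min_r (ltW (lt_le_trans ap ab))) lerD2r le_min !ge_min ab lexx.
by rewrite orbT.
Qed.

Lemma overlap_eq0 a b p q : a <= b -> p <= q -> (q < a) || (b < p) ->
  overlap a b p q = 0.
Proof.
move=> ab pq /orP[qa|bp]; rewrite /overlap.
  have pa := le_lt_trans pq qa.
  by rewrite !min_r ?subrr// ltW// (lt_le_trans _ ab).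
have ap := le_lt_trans ab bp.
by rewrite !min_l ?subrr// ltW// (lt_le_trans _ pq).
Qed.

End partitions.

Section uniform_continuity.
Context {R : realType} {X : normedModType R[i]}.

(** Compactness of the interval, in near-covering form, applied to the
    moduli of continuity at its points. *)
Lemma unif_continuous_itv (y : R -> X) (S : R) :
  {within `[0, +oo[, continuous y} ->
  forall e : R, 0 < e -> exists2 d : R, 0 < d &
    forall a b, 0 <= a <= S -> 0 <= b <= S -> `|a - b| < d -> nm (y a - y b) <= e.
Proof.
move=> /subspace_continuousP cy e e0.
pose P (h a : R) := forall b, 0 <= a <= S -> 0 <= b <= S -> `|a - b| < h ->
  nm (y a - y b) <= e.
have hP : \forall h \near (0:R)^'+, `[0, S] `<=` P h.
  have /compact_near_coveringP := @segment_compact R 0 S.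
  apply => x; rewrite /= in_itv /= => /andP[x0 xS].
  have xA : `[0, +oo[%classic x by rewrite /= in_itv /= x0.
  have /nm_cvgP /(_ (e / 2) (divr_gt0 e0 (ltr0Sn _ _))) := cy x xA.
  rewrite /prop_near1 /within /= => /nbhs_ballP[r /= r0 hr].
  have hrA a : `|a - x| < r -> 0 <= a -> nm (y a - y x) <= e / 2.
    move=> ax a0; apply: hr; last by rewrite /= in_itv /= a0.
    by rewrite /ball /= distrC.
  have r20 : 0 < r / 2 by rewrite divr_gt0.
  exists (ball x (r / 2), [set h | 0 < h < r / 2]) => /=.
    split; first exact: nbhsx_ballx.
    near=> h; rewrite /=; apply/andP; split; near: h.
      exact: nbhs_right_gt.
    exact: nbhs_right_lt.
  move=> [a h] /= [ax /andP[h0 hr2]] b /andP[a0 _] /andP[b0 _] ab.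
  apply: le_trans (nm_dist _ (y x) _) _; rewrite [e]splitr [nm (_ - y b)]nm_distC.
  rewrite /ball /= in ax.
  rewrite lerD// hrA//.
    by rewrite distrC (lt_trans ax)// ltr_pdivrMr// ltr_pMr// ltr1n.
  have : `|b - x| <= `|a - b| + `|x - a|.
    by rewrite [`|x - a|]distrC -[`|a - b|]distrC (le_trans _ (ler_normD _ _))// addrA subrK.
  move=> /le_lt_trans; apply; rewrite [r]splitr ltrD//.
  exact: lt_trans ab hr2.
have [d [/= d0 dP]] := filter_ex (filterI (nbhs_right_gt (0 : R)) hP).
exists d => // a b aS bS ab.
by apply: dP => //; rewrite /= in_itv.
Unshelve. all: by end_near. Qed.

End uniform_continuity.

Section primitives.
Context {R : realType} {X : normedModType R[i]}.
Context (y : R -> X) (S : R).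
Context (uc : forall e : R, 0 < e -> exists2 d : R, 0 < d &
  forall a b, 0 <= a <= S -> 0 <= b <= S -> `|a - b| < d -> nm (y a - y b) <= e).

(** The increments of [F] are those of a primitive of [y], with a relative error
    [eta]. *)
Definition near_primitive (eta : R) (F : R -> X) : Prop :=
  forall a b (v : X) (c : R), 0 <= a -> a <= b -> b <= S ->
    (forall s, a <= s <= b -> nm (y s - v) <= c) ->
    nm (F b - F a - (b - a)%:C *: v) <= (b - a) * (c + eta).

(** On a cell of small mesh [y] is within [e] of its value at the tag, so that the
    increment of [F] is within [e + eta], per unit of length, of the term of the sum.
    This compares any two Riemann sums without a common refinement. *)
Lemma riemann_sum_primitive (F : R -> X) (eta e : R) :
  near_primitive eta F -> 0 < e -> exists2 d : R, 0 < d &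
  forall a b n x xi, 0 <= a -> b <= S -> tagged_partition a b n x xi ->
    (forall k, (k < n)%N -> x k.+1 - x k < d) ->
    nm (riemann_sum y n x xi - (F b - F a)) <= (b - a) * (e + eta).
Proof.
move=> hF e0; have [d d0 hd] := uc e0; exists d => // a b n x xi a0 bS px mesh.
have itv := tagged_partition_itv px.
have [xa xb hx] := px.
have telesc (V : zmodType) (f : nat -> V) : f n - f 0%N = \sum_(0 <= k < n) (f k.+1 - f k).
  by rewrite telescope_sumr.
rewrite -{1}xb -{1}xa (telesc X (fun k => F (x k))) /riemann_sum -sumrB.
rewrite -{1}xb -{1}xa (telesc R x) mulr_suml.
apply: le_trans (nm_sum _ _ _) _; rewrite big_nat [leRHS]big_nat.
apply: ler_sum => k /= kn; rewrite nm_distC.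
have /andP[h1 h2] := hx k kn.
have /andP[ak _] := itv k (ltnW kn); have /andP[_ kb] := itv k.+1 kn.
apply: hF; [exact: le_trans ak|exact: le_trans h2|exact: le_trans bS|].
move=> s /andP[s1 s2]; have m := mesh k kn.
apply: hd; [apply/andP; split; lra..|].
by rewrite ltr_norml; apply/andP; split; lra.
Qed.

Lemma primitive_riemann_integral (F : R -> X) : near_primitive 0 F ->
  forall a b, 0 <= a -> a <= b -> b <= S -> is_riemann_integral y a b (F b - F a).
Proof.
move=> hF a b a0 ab bS e e0.
have ba1 : 0 < b - a + 1 by rewrite ltr_wpDl// subr_ge0.
have [d d0 hd] := riemann_sum_primitive hF (divr_gt0 e0 ba1).
exists d => // n x xi px mesh; rewrite nmE ltcR.
apply: le_lt_trans (hd _ _ _ _ _ a0 bS px mesh) _.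
by rewrite addr0 mulrCA gtr_pMr// ltr_pdivrMr// mul1r ltrDl.
Qed.

End primitives.

Section riemann_uniqueness.
Context {R : realType} {X : normedModType R[i]}.

Lemma is_riemann_integral_unique (y : R -> X) a b v w : a <= b ->
  is_riemann_integral y a b v -> is_riemann_integral y a b w -> v = w.
Proof.
move=> ab hv hw; apply/eqP; rewrite -subr_eq0; apply/eqP/le0_nm_eq0 => e e0.
have e20 : 0 < e / 2 by rewrite divr_gt0.
have [d1 d10 h1] := hv _ e20; have [d2 d20 h2] := hw _ e20.
have d0 : 0 < Num.min d1 d2 by rewrite lt_min d10.
have [n hn] := fine_uniform_partition a b d0.
have px := uniform_partition_tagged n ab.
have {}h1 := h1 _ _ _ px (fun k _ => lt_le_trans (hn k) _).
have {}h2 := h2 _ _ _ px (fun k _ => lt_le_trans (hn k) _).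
set u := uniform_partition a b n in px h1 h2.
apply: le_trans (nm_dist _ (riemann_sum y n.+1 u u) _) _.
rewrite [e]splitr lerD// ltW// -ltcR -nmE; last by apply: h2; rewrite ge_min lexx orbT.
by rewrite distrC; apply: h1; rewrite ge_min lexx.
Qed.

End riemann_uniqueness.

Section existence.
Context {R : realType} {X : completeNormedModType R[i]}.
Context (y : R -> X) (S : R) (S0 : 0 <= S).
Context (uc : forall e : R, 0 < e -> exists2 d : R, 0 < d &
  forall a b, 0 <= a <= S -> 0 <= b <= S -> `|a - b| < d -> nm (y a - y b) <= e).

Let x n k : R := uniform_partition 0 S n k.

(** A primitive of the step function that takes the value [y (x n k)] on the
    [k]-th cell of the uniform partition. *)
Definition step_primitive n t : X :=
  \sum_(0 <= k < n.+1) (Num.min t (x n k.+1) - Num.min t (x n k))%:C *: y (x n k).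

Lemma step_primitive0 n : step_primitive n 0 = 0.
Proof.
rewrite /step_primitive big1// => k _.
have x0 j : 0 <= x n j.
  by rewrite /x /uniform_partition add0r subr0 mulr_ge0// divr_ge0.
by rewrite !min_l ?subrr ?scale0r.
Qed.

(** The increment of the step primitive over [[a, b]] is a sum of values at the points
    [x n k], weighted by the overlaps of the cells with [[a, b]]. A cell that overlaps
    may start before [a], but by no more than the mesh. *)
Lemma step_near_primitive e : 0 < e -> exists N, forall n, (N <= n)%N ->
  near_primitive y S e (step_primitive n).
Proof.
move=> e0; have [d d0 hd] := uc e0.
exists (Num.bound (S / d)) => n Nn a b v c a0 ab bS hv.
have hn : S / n.+1%:R < d.
  rewrite ltr_pdivrMr// mulrC -ltr_pdivrMr//.
  apply: lt_le_trans (archi_boundP (divr_ge0 S0 (ltW d0))) _.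
  by rewrite ler_nat; exact: leqW.
have px := uniform_partition_tagged n S0.
have x0 : x n 0%N = 0 by have [] := px.
have xS : x n n.+1 = S by have [] := px.
have xs k : x n k.+1 - x n k = S / n.+1%:R by rewrite /x uniform_partitionS subr0.
pose m t k := Num.min t (x n k).
have tel t : 0 <= t <= S -> \sum_(0 <= k < n.+1) (m t k.+1 - m t k) = t.
  move=> /andP[t0 tS]; rewrite telescope_sumr// /m x0 xS.
  by rewrite (min_l tS) (min_r t0) subr0.
pose l k := overlap a b (x n k) (x n k.+1).
have sl : b - a = \sum_(0 <= k < n.+1) l k.
  by rewrite sumrB !tel// ?a0 ?(le_trans ab) ?(le_trans a0).
have -> : step_primitive n b - step_primitive n a - (b - a)%:C *: v =
    \sum_(0 <= k < n.+1) (l k)%:C *: (y (x n k) - v).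
  rewrite {1}sl rmorph_sum scaler_suml /step_primitive -!sumrB.
  apply: eq_bigr => k _.
  by rewrite -/(m b k.+1) -/(m b k) -/(m a k.+1) -/(m a k) scalerBr -scalerBl -rmorphB.
rewrite [leRHS](_ : _ = \sum_(0 <= k < n.+1) (l k * (c + e))); last by rewrite -mulr_suml -sl.
apply: le_trans (nm_sum _ _ _) _; rewrite big_nat [leRHS]big_nat.
apply: ler_sum => k /= kn; rewrite nmZr.
have pq : x n k <= x n k.+1 by rewrite -subr_ge0 xs divr_ge0.
have l0 : 0 <= l k by exact: overlap_ge0.
rewrite ger0_norm//.
have [->|ln0] := eqVneq (l k) 0; first by rewrite !mul0r.
rewrite ler_wpM2l//.
have /andP[k0 kS] := tagged_partition_itv px (ltnW kn); rewrite -/(x n k) in k0 kS.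
have [ak kb] : a <= x n k.+1 /\ x n k <= b.
  by split; rewrite leNgt; apply: contra ln0 => hh; apply/eqP/overlap_eq0;
    rewrite ?hh ?orbT.
have [ka|ka] := leP a (x n k).
  by apply: le_trans (hv _ _) _; rewrite ?ka// lerDl ltW.
apply: le_trans (nm_dist _ (y a) _) _; rewrite addrC lerD ?hv ?lexx//.
apply: hd; [by rewrite k0|by rewrite a0 (le_trans ab)|].
have := xs k; move: hn; set p := S / _ => hn xsk.
by rewrite ltr_norml; apply/andP; split; lra.
Qed.

(** All step primitives are close to the same fine Riemann sum, hence to each other. *)
Lemma ex_primitive : exists F : R -> X, F 0 = 0 /\ near_primitive y S 0 F.
Proof.
have close (e : R) : 0 < e -> exists N, forall m n t,
    (N <= m)%N -> (N <= n)%N -> 0 <= t <= S ->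
    nm (step_primitive m t - step_primitive n t) <= e.
  move=> e0; have S1 : 0 < 4 * (S + 1) by rewrite mulr_gt0// ltr_wpDl.
  have p0 := divr_gt0 e0 S1; set p := e / _ in p0.
  have [N hN] := step_near_primitive p0.
  exists N => m n t Nm Nn /andP[t0 tS].
  have [d1 d10 h1] := riemann_sum_primitive uc (hN m Nm) p0.
  have [d2 d20 h2] := riemann_sum_primitive uc (hN n Nn) p0.
  have d0 : 0 < Num.min d1 d2 by rewrite lt_min d10.
  have [j hj] := fine_uniform_partition 0 t d0.
  have px := uniform_partition_tagged j t0.
  have {}h1 := h1 _ _ _ _ _ (lexx _) tS px (fun k _ => lt_le_trans (hj k) _).
  have {}h2 := h2 _ _ _ _ _ (lexx _) tS px (fun k _ => lt_le_trans (hj k) _).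
  rewrite !step_primitive0 !subr0 in h1 h2.
  set u := uniform_partition 0 t j in px h1 h2.
  apply: le_trans (nm_dist _ (riemann_sum y j.+1 u u) _) _.
  rewrite nm_distC; apply: le_trans (lerD (h1 _) (h2 _)) _.
  - by rewrite ge_min lexx.
  - by rewrite ge_min lexx orbT.
  have : 4 * (S + 1) * p = e by rewrite /p mulrC divfK// gt_eqF.
  have : t * p <= S * p by rewrite ler_wpM2r// ltW.
  lra.
have ex_lim t : exists l : X, 0 <= t <= S -> step_primitive n t @[n --> \oo] --> l.
  have [tS|] := boolP (0 <= t <= S); last by exists 0.
  have [l hl] : exists l : X, step_primitive n t @[n --> \oo] --> l.
    apply: nm_cauchy_cvg => e /close[N hN]; exists N => m n Nm Nn.
    exact: hN.
  by exists l.
have [F hF] := choice ex_lim.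
exists F; split.
  have h0 : (0 : R) <= 0 <= S by rewrite lexx.
  apply: le0_nm_eq0 => e e0; rewrite -[F 0]subr0; apply: nm_cvgn_le (hF 0 h0) _.
  by exists 0%N => // n _ /=; rewrite step_primitive0 subrr nm0 ltW.
move=> a b v c a0 ab bS hv; rewrite addr0.
have aI : 0 <= a <= S by rewrite a0 (le_trans ab).
have bI : 0 <= b <= S by rewrite bS (le_trans a0).
apply/ler_addgt0Pr => e e0.
have b1 : 0 < b - a + 2 by rewrite ltr_wpDl// subr_ge0.
have p0 := divr_gt0 e0 b1; set p := e / _ in p0.
have [N1 hN1] := step_near_primitive p0.
have [N2 hN2] := nm_cvgn (hF a aI) p0.
have [N3 hN3] := nm_cvgn (hF b bI) p0.
pose n := maxn N1 (maxn N2 N3).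
have h1 := hN1 n (leq_maxl _ _) a b v c a0 ab bS hv.
have h2 : nm (step_primitive n a - F a) <= p.
  by apply: hN2; rewrite /n maxnCA leq_maxl.
have h3 : nm (step_primitive n b - F b) <= p.
  by apply: hN3; rewrite /n maxnA leq_maxr.
have -> : F b - F a - (b - a)%:C *: v =
  (step_primitive n b - step_primitive n a - (b - a)%:C *: v) +
  ((step_primitive n a - F a) - (step_primitive n b - F b)).
  set u := _ *: v; set f := step_primitive n b; set g := step_primitive n a.
  rewrite opprB [RHS]addrC [g - F a + _]addrC [F b - f + _]addrACA [- f - F a]addrC.
  by rewrite [F b + g + _]addrACA -(opprB f g) addrA subrK.
have := nmD (step_primitive n b - step_primitive n a - (b - a)%:C *: v)
   ((step_primitive n a - F a) - (step_primitive n b - F b)).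
have := nmB (step_primitive n a - F a) (step_primitive n b - F b).
have : (b - a + 2) * p = e by rewrite /p mulrC divfK// gt_eqF.
lra.
Qed.

End existence.

(** * Euler's method *)

Section euler_numbers.
Context {R : realType}.

Lemma bernoulli (x : R) n : -1 <= x -> 1 + n%:R * x <= (1 + x) ^+ n.
Proof.
move=> x1; elim: n => [|n IH]; first by rewrite mul0r addr0 expr0.
rewrite exprSr; have x0 : 0 <= 1 + x by lra.
apply: le_trans (ler_wpM2r x0 IH); rewrite -natr1.
have : 0 <= n%:R * (x * x) by rewrite mulr_ge0// -expr2 sqr_ge0.
lra.
Qed.

(** Because [(1 - 2 * x) * (1 + x) ^+ 2 = 1 - x ^+ 2 * (3 + 2 * x)]. *)
Lemma le_inv_of_sqr (x m : R) : - 2^-1 <= x -> 0 <= m -> m ^+ 2 <= 1 - 2 * x ->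
  m <= (1 + x)^-1.
Proof.
move=> x1 m0 mx; have x0 : 0 < 1 + x by lra.
rewrite -[(1 + x)^-1]mul1r ler_pdivlMr//.
rewrite -(@expr_le1 _ 2)//; last by rewrite mulr_ge0// (ltW x0).
rewrite exprMn.
apply: le_trans (ler_wpM2r (sqr_ge0 _) mx) _.
have : 0 <= x ^+ 2 * (3 + 2 * x) by rewrite mulr_ge0 ?sqr_ge0//; lra.
rewrite !expr2; lra.
Qed.

(** Bernoulli's inequality bounds the powers of [1 + x], with [x] the decay
    over one step of length [S / (k + 1)] and [eta] a loss due to the discretization.
    The rate [1 / (1 + S * eps)] is weaker than the exponential one, but tends to [0] as well. *)
Lemma euler_powers (S eps eta : R) k : 0 <= S -> 0 <= eps -> 0 <= eta -> S * eta <= 1 ->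
  let x := S / k.+1%:R * (eps - eta / 2) in
  [/\ - 2^-1 <= x, forall i, (i <= k.+1)%N -> (1 + x)^-1 ^+ i <= 2
    & (1 + x)^-1 ^+ k.+1 <= 2 / (1 + S * eps)].
Proof.
move=> S0 eps0 eta0 Seta x.
have k0 : (0 : R) < k.+1%:R by [].
have ix i : (i <= k.+1)%N -> - 2^-1 <= i%:R * x.
  move=> ik; rewrite /x mulrA mulrCA.
  have p0 : 0 <= i%:R / k.+1%:R :> R by rewrite divr_ge0.
  have p1 : i%:R / k.+1%:R <= 1 :> R by rewrite ler_pdivrMr// mul1r ler_nat.
  set p := _ / _ in p0 p1 *.
  have h1 : 0 <= p * (S * eps) by rewrite !mulr_ge0.
  have h2 : p * (S * eta) <= S * eta by rewrite ler_piMl// mulr_ge0.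
  lra.
have x2 : - 2^-1 <= x by have := ix 1%N isT; rewrite mul1r.
have x1 : - 1 <= x by lra.
have x0 : 0 < 1 + x by lra.
split=> // [i ik|].
  rewrite exprVn -[2]invrK lef_pV2 ?posrE ?exprn_gt0 ?invr_gt0//.
  by apply: le_trans (bernoulli i x1); have := ix i ik; lra.
have Se : 0 < 1 + S * eps by rewrite ltr_pwDl// mulr_ge0.
rewrite exprVn -invf_div lef_pV2 ?posrE ?exprn_gt0 ?divr_gt0//.
apply: le_trans (bernoulli k.+1 x1).
have -> : k.+1%:R * x = S * eps - S * eta / 2.
  rewrite /x; field; rewrite ?pnatr_eq0//.
have : 0 <= S * eps by rewrite mulr_ge0.
lra.
Qed.

Lemma normc_sqr (z : R[i]) : normc z ^+ 2 = complex.Re z ^+ 2 + complex.Im z ^+ 2.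
Proof. by case: z => a b /=; rewrite sqr_sqrtr ?addr_ge0 ?sqr_ge0. Qed.

(** Here [1 + h * kappa * s] is the multiplier of one Euler step for the equation
    [w' = kappa * s * w]. The quadratic term [h ^+ 2 * |s| ^+ 2] and the error [delta]
    make up the loss [2 * delta + h * (N + 1) ^+ 2]. *)
Lemma euler_factor (h kappa eps delta N : R) (z s : R[i]) :
  0 <= h -> `|kappa| <= 1 -> 0 <= delta <= 1 -> 0 <= N ->
  normc z <= N -> normc (s - z) <= delta -> kappa * complex.Re z <= - eps ->
  normc (1 + (h * kappa)%:C * s) ^+ 2 <=
    1 - 2 * (h * (eps - (2 * delta + h * (N + 1) ^+ 2) / 2)).
Proof.
move=> h0 k1 /andP[d0 d1] N0 zN sz kz.
have sN : normc s <= N + 1.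
  have := normc_triangle (s - z) z; rewrite subrK; lra.
have sN2 : normc s ^+ 2 <= (N + 1) ^+ 2.
  by rewrite ler_pXn2r ?nnegrE ?normc_ge0// addr_ge0.
have k2 : kappa ^+ 2 <= 1.
  by rewrite -real_normK ?num_real// expr_le1.
have ks : kappa * complex.Re s <= - eps + delta.
  have hRe := le_trans (Re_dist s z) sz.
  have : kappa * (complex.Re s - complex.Re z) <= delta.
    apply: le_trans (ler_norm _) _; rewrite normrM.
    by apply: le_trans hRe; rewrite ler_piMl.
  by rewrite mulrBr; lra.
have -> : normc (1 + (h * kappa)%:C * s) ^+ 2 =
    1 + 2 * h * (kappa * complex.Re s) + h ^+ 2 * (kappa ^+ 2 * normc s ^+ 2).
  by rewrite !normc_sqr; case: s {sz sN sN2 ks} => a b /=; ring.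
have h1 : 2 * h * (kappa * complex.Re s) <= 2 * h * (- eps + delta).
  by rewrite ler_wpM2l// mulr_ge0.
have h2 : h ^+ 2 * (kappa ^+ 2 * normc s ^+ 2) <= h ^+ 2 * (N + 1) ^+ 2.
  rewrite ler_wpM2l ?sqr_ge0//; apply: le_trans sN2.
  by rewrite ler_piMl// sqr_ge0.
rewrite !expr2 in h1 h2 *; lra.
Qed.

End euler_numbers.

Section euler_scheme.
Context {R : realType} {X : completeNormedModType R[i]}.
Context (A : partial_op X) (E : set R[i] -> {linear X -> X}).
Context (hA : scalar_type_spectral A E).

Let hE : spectral_measure E. Proof. by case: hA. Qed.

Context (C : R) (C0 : 0 <= C).
Context (hC : simple_integral_bound E C).

Context (D : set R[i]) (N : R).
Context (mD : borel_set D) (Ds : D `<=` spectrum A).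
Context (DN : forall z, D z -> normc z <= N).
Context (w : R -> X) (S kappa eps W : R).
Context (S0 : 0 <= S) (kappa1 : `|kappa| <= 1) (eps0 : 0 <= eps).
Context (Dw : forall t, 0 <= t <= S -> E D (w t) = w t).
Context (wW : forall t, 0 <= t <= S -> nm (w t) <= W).
Context (kD : forall z, D z -> kappa * complex.Re z <= - eps).
Context (dw : forall e : R, 0 < e -> exists2 d : R, 0 < d &
  forall a b, 0 <= a -> a <= b -> b <= S -> b - a < d ->
    nm (w b - w a - ((b - a) * kappa)%:C *: A (w a)) <= e * (b - a)).

(** One explicit Euler step multiplies by [1 + h kappa s], where [s] is a simple
    approximation of the identity on [D]; iterating this on a simple function
    costs the factor [C] only once. *)
Lemma euler_decay : nm (w S) <= 2 * C / (1 + S * eps) * nm (w 0).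
Proof.
have N0 : 0 <= `|N| by [].
have DN' z : D z -> normc z <= `|N| by move=> /DN/le_trans; apply; exact: ler_norm.
have W0 : 0 <= W by apply: le_trans (wW (t := S) _); rewrite ?nm_ge0 ?S0 ?lexx.
apply/ler_addgt0Pr => theta theta0.
have c0 : 0 < 4 * (C + 1) * (S + 1) by rewrite !mulr_gt0// ltr_wpDl.
have e0 := divr_gt0 theta0 c0; set e := theta / _ in e0.
have [d d0 hd] := dw e0.
pose delta := Num.min (Num.min 1 (4 * (S + 1))^-1) (e / (W + 1)).
have S1 : 0 < S + 1 by rewrite ltr_wpDl.
have W1 : 0 < W + 1 by rewrite ltr_wpDl.
have delta0 : 0 < delta by rewrite !lt_min ltr01 invr_gt0 mulr_gt0//= divr_gt0.
have delta1 : delta <= 1 by rewrite !ge_min lexx.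
have deltaS : delta * S <= 4^-1.
  apply: (@le_trans _ _ ((4 * (S + 1))^-1 * S)).
    by rewrite ler_wpM2r// !ge_min lexx orbT.
  by rewrite invfM -mulrA ler_piMr// mulrC ler_pdivrMr// mul1r lerDl.
have deltaW : delta * W <= e.
  apply: (@le_trans _ _ (e / (W + 1) * W)).
    by rewrite ler_wpM2r// !ge_min lexx !orbT.
  by rewrite mulrAC ler_pdivrMr// ler_wpM2l ?lerDl// ltW.
have [s [ss sD sA]] := app_approx hA mD Ds DN delta0.
pose N2 := (`|N| + 1) ^+ 2; have N20 : 0 <= N2 by rewrite sqr_ge0.
have [k hk] : exists k, S / k.+1%:R < d /\ S ^+ 2 * N2 / k.+1%:R <= 2^-1.
  have m0 : 0 < Num.min d (2 * (S * N2 + 1))^-1.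
    by rewrite lt_min d0 invr_gt0 mulr_gt0// ltr_wpDl// mulr_ge0.
  have [k hk] := fine_uniform_partition 0 S m0; exists k.
  have := hk 0%N; rewrite uniform_partitionS subr0 lt_min => /andP[-> /ltW h].
  split=> //; rewrite expr2.
  have -> : S * S * N2 / k.+1%:R = S / k.+1%:R * (S * N2) by ring.
  apply: le_trans (ler_wpM2r _ h) _; first by rewrite mulr_ge0.
  by rewrite invfM -mulrA ler_piMr// mulrC ler_pdivrMr ?mul1r ?lerDl// ltr_wpDl// mulr_ge0.
have [hkd hkN] := hk.
pose h := S / k.+1%:R; have h0 : 0 <= h by rewrite divr_ge0.
pose eta := 2 * delta + h * N2.
have eta0 : 0 <= eta by rewrite addr_ge0// ?mulr_ge0// ltW.
have Seta : S * eta <= 1.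
  have -> : S * eta = 2 * (delta * S) + S ^+ 2 * N2 / k.+1%:R.
    by rewrite /eta /h expr2; ring.
  by move: hkN; set p := _ / k.+1%:R => hkN; lra.
have [x2 qi qk] := euler_powers k S0 eps0 eta0 Seta.
rewrite -/h in x2 qi qk; set x := h * _ in x2 qi qk; set q := (1 + x)^-1 in qi qk.
have x0 : 0 < 1 + x by lra.
have q0 : 0 <= q by rewrite invr_ge0 ltW.
pose r z := 1 + (h * kappa)%:C * s z.
have sr : simple_function r by exact: (simple_op2 (fun a _ => 1 + (h * kappa)%:C * a) ss ss).
have rq z : D z -> normc (r z) <= q.
  move=> Dz; apply: le_inv_of_sqr => //; first exact: normc_ge0.
  by apply: euler_factor (DN' z Dz) (sD z Dz) (kD Dz) => //; rewrite delta1 ltW.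
have srj j : simple_function (fun z => r z ^+ j).
  exact: (simple_op2 (fun a _ => a ^+ j) sr sr).
have rjq j u : E D u = u -> nm (simple_integral E (fun z => r z ^+ j) u) <= C * q ^+ j * nm u.
  move=> Du; apply: (hC _ mD) => //; first exact: exprn_ge0.
  move=> z Dz; have -> : normc (r z ^+ j) = normc (r z) ^+ j.
    elim: j => [|j IH]; first by rewrite !expr0 normc1.
    by rewrite !exprS normcM IH.
  by rewrite lerXn2r ?nnegrE ?normc_ge0// rq.
have rE u : simple_integral E r u = u + (h * kappa)%:C *: simple_integral E s u.
  rewrite (simple_integralD hE (s := fun=> 1) (s' := fun z => (h * kappa)%:C * s z)) //.
  - rewrite (simple_integral_cst hE) scale1r (simple_integralM hE)//; last exact: simple_cst.
    by rewrite (simple_integral_cst hE).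
  - exact: simple_cst.
  - exact: (simple_op2 (fun a _ => (h * kappa)%:C * a) ss ss).
pose t j := uniform_partition 0 S k j.
have px := uniform_partition_tagged k S0.
have tS j : (j <= k.+1)%N -> 0 <= t j <= S by move=> jk; exact: (tagged_partition_itv px jk).
have tj j : t j.+1 - t j = h by rewrite /t uniform_partitionS subr0.
pose rho j := w (t j.+1) - simple_integral E r (w (t j)).
have Drho j : (j < k.+1)%N -> E D (rho j) = rho j.
  by move=> jk; rewrite /rho linearB /= -(simple_integral_specC hE)// !Dw// tS// ltnW.
have hrho j : (j < k.+1)%N -> nm (rho j) <= h * (2 * e).
  move=> jk; have jk' := ltnW jk.
  have [_ h1] := sA _ (Dw (tS j jk')).
  have /andP[t0 _] := tS j jk'; have /andP[_ t1] := tS j.+1 jk.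
  have h2 : nm (w (t j.+1) - w (t j) - (h * kappa)%:C *: A (w (t j))) <= e * h.
    by rewrite -(tj j); apply: hd => //; rewrite ?tj// -subr_ge0 tj.
  have -> : rho j = (w (t j.+1) - w (t j) - (h * kappa)%:C *: A (w (t j))) +
      (h * kappa)%:C *: (A (w (t j)) - simple_integral E s (w (t j))).
    by rewrite /rho rE scalerBr opprD !addrA subrK.
  apply: le_trans (nmD _ _) _; rewrite nmZr normrM (ger0_norm h0).
  have h3 : `|kappa| * nm (A (w (t j)) - simple_integral E s (w (t j))) <= e.
    apply: le_trans (ler_piMl (nm_ge0 _) kappa1) _; apply: le_trans h1 _.
    by apply: le_trans deltaW; rewrite ler_wpM2l ?wW ?tS// ltW.
  have := ler_wpM2l h0 h3; rewrite mulrA; lra.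
(* the error of each step is propagated by at most [k + 1] Euler steps, all of whose
   powers have norm at most [2 * C] *)
have main j : (j <= k.+1)%N -> forall i, (i + j <= k.+1)%N ->
    nm (simple_integral E (fun z => r z ^+ i) (w (t j))) <=
    C * q ^+ (i + j) * nm (w 0) + j%:R * (2 * C * (h * (2 * e))).
  elim: j => [|j IH] jk i ijk.
    have t0 : t 0%N = 0 by have [] := px.
    by rewrite mul0r addr0 addn0 t0 rjq// -t0 Dw// tS.
  have -> : w (t j.+1) = 1 *: simple_integral E r (w (t j)) + rho j.
    by rewrite scale1r /rho addrC subrK.
  rewrite (simple_integral_linear hE)// scale1r -(simple_integralM hE)//.
  have -> : (fun z => r z ^+ i * r z) = (fun z => r z ^+ i.+1).
    by apply/funext => z; rewrite exprSr.
  rewrite addnS -addSn in ijk *.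
  apply: le_trans (nmD _ _) _; rewrite -natr1 mulrDl mul1r addrA.
  apply: lerD; first exact: IH (ltnW jk) _ ijk.
  apply: le_trans (rjq _ _ (Drho j jk)) _.
  apply: ler_pM; rewrite ?nm_ge0 ?hrho ?mulr_ge0 ?exprn_ge0//.
  rewrite [leRHS]mulrC ler_wpM2l// qi//.
  by rewrite (leq_trans _ ijk)// (leq_trans (leqnSn _))// leq_addr.
have := main k.+1 (leqnn _) 0%N (leqnn _).
rewrite add0n (_ : (fun z => r z ^+ 0) = (fun=> 1)); last by apply/funext.
rewrite (simple_integral_cst hE) scale1r.
have -> : t k.+1 = S by have [] := px.
move=> /le_trans; apply; apply: lerD.
  rewrite ler_wpM2r ?nm_ge0//; apply: le_trans (ler_wpM2l C0 qk) _.
  by rewrite mulrCA mulrA.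
have -> : k.+1%:R * (2 * C * (h * (2 * e))) = 4 * C * S * e.
  have -> : 4 * C * S * e = h * k.+1%:R * (4 * C * e) by rewrite /h divfK//; ring.
  by clearbody h; ring.
have : 4 * (C + 1) * (S + 1) * e = theta by rewrite /e mulrC divfK// gt_eqF.
have : 0 <= C * e by rewrite mulr_ge0// ltW.
have : 0 <= S * e by rewrite mulr_ge0// ltW.
lra.
Qed.

End euler_scheme.

(** * Bounded weak solutions *)

Section vector_riemann_integral.
Context {R : realType} {X : completeNormedModType R[i]}.
Context (y : R -> X) (cy : {within `[0, +oo[, continuous y}).

(** A single primitive on [[0, S]] identifies all the integrals from [0] to a point
    of that interval. *)
Lemma riemann_integral_primitive S :
  0 <= S -> riemann_integral y 0 0 = 0 /\ near_primitive y S 0 (riemann_integral y 0).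
Proof.
move=> S0; have uc := unif_continuous_itv S cy.
have [F [F0 hF]] := ex_primitive S0 uc.
have intE t : 0 <= t -> t <= S -> riemann_integral y 0 t = F t.
  move=> t0 tS; have iF := primitive_riemann_integral uc hF (lexx _) t0 tS.
  rewrite F0 subr0 in iF; apply: is_riemann_integral_unique t0 _ (iF).
  exact: (@getPex _ (is_riemann_integral y 0 t) (ex_intro _ _ iF)).
split=> [|a b v c a0 ab bS]; first by rewrite intE.
by rewrite !intE ?(le_trans ab)// ?(le_trans a0)//; apply: hF.
Qed.

(** For Riemann sums this is the triangle inequality. *)
Lemma riemann_integral_linear (L : {linear X -> X}) (M a b : R) (v : X) (c : R) :
  0 <= M -> (forall x, nm (L x) <= M * nm x) -> 0 <= a -> a <= b ->
  (forall s, a <= s <= b -> nm (L (y s) - v) <= c) ->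
  nm (L (riemann_integral y 0 b) - L (riemann_integral y 0 a) - (b - a)%:C *: v) <=
  (b - a) * c.
Proof.
move=> M0 LM a0 ab hv; have b0 := le_trans a0 ab.
have [_ hI] := riemann_integral_primitive b0.
set I := riemann_integral y 0 in hI *.
apply/ler_addgt0Pr => e e0.
have c0 : 0 < M * (b - a) + 1 by rewrite ltr_wpDl// mulr_ge0// subr_ge0.
have p0 := divr_gt0 e0 c0; set p := e / _ in p0.
have [d d0 hd] := riemann_sum_primitive (unif_continuous_itv b cy) hI p0.
have [n hn] := fine_uniform_partition a b d0.
have px := uniform_partition_tagged n ab.
have {hd} := hd _ _ _ _ _ a0 (lexx _) px (fun k _ => hn k).
set x := uniform_partition a b n in px hn *; set rs := riemann_sum _ _ _ _ => hrs.
have hL : nm (L rs - (b - a)%:C *: v) <= (b - a) * c.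
  have [xa xb hx] := px.
  have -> : b - a = \sum_(0 <= k < n.+1) (x k.+1 - x k).
    by rewrite telescope_sumr// xa xb.
  rewrite mulr_suml rmorph_sum scaler_suml /rs /riemann_sum linear_sum -sumrB.
  apply: le_trans (nm_sum _ _ _) _; rewrite big_nat [leRHS]big_nat.
  apply: ler_sum => k /= kn; have /andP[h1 h2] := hx k kn.
  rewrite linearZ /= -scalerBr nmZr ger0_norm; last by rewrite subr_ge0 (le_trans h1 h2).
  rewrite ler_wpM2l//; first by rewrite subr_ge0 (le_trans h1 h2).
  by apply: hv; apply: tagged_partition_itv px _ (ltnW kn).
have -> : L (I b) - L (I a) - (b - a)%:C *: v =
    (L rs - (b - a)%:C *: v) - L (rs - (I b - I a)).
  rewrite [L (rs - _)]linearB [L (I b - _)]linearB /= opprB [RHS]addrC.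
  by rewrite [RHS]addrA subrK.
apply: le_trans (nmB _ _) _; apply: lerD hL _.
apply: le_trans (LM _) _; apply: le_trans (ler_wpM2l M0 hrs) _.
have : (M * (b - a) + 1) * p = e by rewrite /p mulrC divfK// gt_eqF.
lra.
Qed.

End vector_riemann_integral.

Section exhaustion.
Context {R : realType}.
Context (S : set R[i]) (mS : borel_set S).
Context (l : R[i] -> R) (hl : forall z w, `|l z - l w| <= normc (z - w)).

Lemma ex_nat_ge (x : R) : exists n : nat, x <= n%:R.
Proof.
exists (Num.bound `|x|); apply: le_trans (ler_norm _) _.
by apply: ltW; apply: archi_boundP.
Qed.

Lemma borel_disc n : borel_set [set z : R[i] | normc z <= n%:R].
Proof. exact: borel_normc_le. Qed.

Lemma sub_disc n : [set z : R[i] | normc z <= n%:R] `<=` [set z | normc z <= n.+1%:R].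
Proof. by move=> z /= zn; rewrite (le_trans zn)// ler_nat. Qed.

(** The part of [S] on which all estimates for [A] are uniform: [l] is the modulus, or
    plus or minus the real part. *)
Definition exhaustion n : set R[i] :=
  S `&` [set z | normc z <= n%:R] `&` [set z | n.+1%:R^-1 <= l z].

Lemma borel_exhaustion n : borel_set (exhaustion n).
Proof.
apply: borel_setI; last exact: borel_ge.
by apply: borel_setI => //; exact: borel_disc.
Qed.

Lemma exhaustion_nondecreasing n : exhaustion n `<=` exhaustion n.+1.
Proof.
move=> z [[Sz zn] /= zl]; split; first by split=> //; exact: sub_disc zn.
by rewrite /= (le_trans _ zl)// lef_pV2 ?posrE// ler_nat.
Qed.

Lemma bigcup_exhaustion : \bigcup_n exhaustion n = S `&` [set z | 0 < l z].
Proof.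
apply/seteqP; split=> z.
  by move=> [n _ [[Sz _] /= zl]]; split=> //=; exact: lt_le_trans zl.
move=> [Sz /= z0]; have [K hK] := inv_nat_lt z0; have [m hm] := ex_nat_ge (normc z).
exists (maxn K m) => //; split; [split=> //=|].
  by rewrite (le_trans hm)// ler_nat leq_maxr.
by rewrite /= ltW// hK// leq_maxl.
Qed.

End exhaustion.

Section bounded_solutions.
Context {R : realType} {X : completeNormedModType R[i]}.
Context (A : partial_op X) (E : set R[i] -> {linear X -> X}).
Context (hA : scalar_type_spectral A E).

Let hE : spectral_measure E. Proof. by case: hA. Qed.
Let sigma := spectrum A.

Context (M : R) (M0 : 0 <= M).
Context (hM : forall D x, borel_set D -> nm (E D x) <= M * nm x).

Context (y : R -> X) (Y : R).
Context (hy : weak_solution A y).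
Context (hY : forall t, 0 <= t -> nm (y t) <= Y).

Let I := riemann_integral y 0.
Let cy : {within `[0, +oo[, continuous y}. Proof. by case: hy. Qed.

Let Y0 : 0 <= Y.
Proof. exact: le_trans (nm_ge0 _) (hY (lexx 0)). Qed.

(** The integrated equation, projected: it involves [A] only on the range of [E D],
    where [A] is bounded as soon as [D] is. *)
Lemma solution_spec D t : borel_set D -> 0 <= t ->
  dom A (E D (I t)) /\ A (E D (I t)) = E D (y t) - E D (y 0).
Proof.
move=> mD t0; have [_ /(_ t t0)[domI yE]] := hy.
have [h1 h2] := dom_spec hA mD domI; split=> //.
by rewrite h2 yE -linearB addrC addKr.
Qed.

Lemma solution_spec0 t : 0 <= t -> E [set 0] (y t) = E [set 0] (y 0).
Proof.
move=> t0; have [_] := solution_spec (borel_set1 0) t0.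
by have [_ ->] := app_spec0 hA (I t) => /esym/eqP; rewrite subr_eq0 => /eqP.
Qed.

(** The estimate is given at both end points of the time step, so that it may
    be used with time reversed. *)
Lemma solution_step D (N : R) : borel_set D -> D `<=` sigma ->
  (forall z, D z -> normc z <= N) -> forall S e : R, 0 < e ->
  exists2 d : R, 0 < d & forall a b, 0 <= a -> a <= b -> b <= S -> b - a < d ->
    forall t, t = a \/ t = b ->
    nm (E D (y b) - E D (y a) - (b - a)%:C *: A (E D (y t))) <= e * (b - a).
Proof.
move=> mD Ds DN S e e0.
have [K K0 hK] := app_bounded hA mD Ds DN.
have c0 : 0 < K * M + 1 by rewrite ltr_wpDl// mulr_ge0.
have p0 := divr_gt0 e0 c0; set p := e / _ in p0.
have [d d0 hd] := unif_continuous_itv S cy p0.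
exists d => // a b a0 ab bS bad t tab; have b0 := le_trans a0 ab.
have [t0 [tb ta]] : 0 <= t /\ (t <= b) /\ (a <= t) by case: tab => ->.
have [Ab Eb] := solution_spec mD b0; have [Aa Ea] := solution_spec mD a0.
set g := E D (I b) - E D (I a).
have Dg : E D g = g by rewrite /g linearB /= !spec_id.
have DDw : E D (E D (y t)) = E D (y t) by rewrite spec_id.
have [Aw _] := hK _ DDw; have [Ag Egx] := domB hA Ab Aa.
have AgE : A g = E D (y b) - E D (y a).
  by rewrite /g Egx Eb Ea opprB addrA subrK.
have [dg AgwE] := dom_linear hA (- (b - a)%:C) Aw Ag.
have -> : E D (y b) - E D (y a) - (b - a)%:C *: A (E D (y t)) =
    A (- (b - a)%:C *: E D (y t) + g).
  by rewrite AgwE AgE scaleNr addrC.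
have Dh : E D (- (b - a)%:C *: E D (y t) + g) = - (b - a)%:C *: E D (y t) + g.
  by rewrite linearP /= DDw Dg.
have [_ h] := hK _ Dh; apply: le_trans h _.
have h1 : nm (- (b - a)%:C *: E D (y t) + g) <= (b - a) * (M * p).
  rewrite scaleNr addrC /g; apply: (riemann_integral_linear cy M0) => // [x|s /andP[sa sb]].
    exact: hM.
  rewrite -linearB; apply: le_trans (hM _ mD) _; rewrite ler_wpM2l//.
  apply: hd; rewrite ?(le_trans a0 sa) ?(le_trans sb bS) ?t0 ?(le_trans tb)//.
  by rewrite ltr_norml; apply/andP; split; lra.
apply: le_trans (ler_wpM2l K0 h1) _.
have : (K * M + 1) * p = e by rewrite /p mulrC divfK// gt_eqF.
have : 0 <= p * (b - a) by rewrite mulr_ge0 ?subr_ge0// ltW.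
have -> : K * ((b - a) * (M * p)) = K * M * p * (b - a) by ring.
move=> h2 h3; rewrite -h3 mulrDl mul1r mulrDl lerDl//.
Qed.

Context (C : R) (C0 : 0 <= C).
Context (hC : simple_integral_bound E C).

(** Euler's method run forwards in time. *)
Lemma solution_decay D (N eps : R) : borel_set D -> D `<=` sigma ->
  (forall z, D z -> normc z <= N) -> 0 <= eps ->
  (forall z, D z -> complex.Re z <= - eps) ->
  forall t, 0 <= t -> nm (E D (y t)) <= 2 * C / (1 + t * eps) * nm (E D (y 0)).
Proof.
move=> mD Ds DN eps0 Deps t t0.
have := @euler_decay _ _ _ _ hA C C0 hC D N mD Ds DN (fun s => E D (y s)) t 1 eps (M * Y).
apply=> //.
- by rewrite normr1.
- by move=> s _; rewrite spec_id.
- move=> s /andP[s0 _]; apply: le_trans (hM _ mD) _.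
  by rewrite ler_wpM2l ?hY.
- by move=> z Dz; rewrite mul1r Deps.
- move=> e e0; have [d d0 hd] := solution_step mD Ds DN t e0.
  exists d => // a b a0 ab bt bad; rewrite mulr1.
  by apply: hd => //; left.
Qed.

(** Euler's method run backwards in time: the component of a bounded solution
    in the right half plane is as small as [1 / (1 + S * eps)] for all [S]. *)
Lemma solution_unstable D (N eps : R) : borel_set D -> D `<=` sigma ->
  (forall z, D z -> normc z <= N) -> 0 < eps ->
  (forall z, D z -> eps <= complex.Re z) ->
  forall t, 0 <= t -> E D (y t) = 0.
Proof.
move=> mD Ds DN eps0 Deps t t0.
have bound S : 0 <= S -> nm (E D (y t)) <= 2 * C / (1 + S * eps) * (M * Y).
  move=> S0; have tS0 : 0 <= t + S by rewrite addr_ge0.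
  have h := @euler_decay _ _ _ _ hA C C0 hC D N mD Ds DN
    (fun s => E D (y (t + S - s))) S (-1) eps (M * Y) S0.
  rewrite subr0 addrK in h.
  apply: le_trans (h _ _ _ _ _ _) _ => //.
  - by rewrite normrN1.
  - exact: ltW.
  - by move=> s _; rewrite spec_id.
  - move=> s /andP[s0 sS]; apply: le_trans (hM _ mD) _.
    by rewrite ler_wpM2l ?hY//; lra.
  - by move=> z Dz; rewrite mulN1r lerN2 Deps.
  - move=> e e0; have [d d0 hd] := solution_step mD Ds DN (t + S) e0.
    exists d => // a b a0 ab bS bad; rewrite mulrN1.
    have ba : t + S - a - (t + S - b) = b - a by ring.
    have := hd (t + S - b) (t + S - a).
    rewrite ba => /(_ _ _ _ bad (t + S - a) (or_intror erefl)); rewrite -nmN.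
    rewrite rmorphN scaleNr !opprB opprK.
    by move=> h'; rewrite [X in nm X]addrC; apply: h'; lra.
  - rewrite ler_wpM2l ?divr_ge0 ?mulr_ge0 ?addr_ge0 ?mulr_ge0 ?(ltW eps0)//.
    by apply: le_trans (hM _ mD) _; rewrite ler_wpM2l// hY.
apply: le0_nm_eq0 => e e0; pose K := 2 * C * (M * Y).
have K0 : 0 <= K by rewrite !mulr_ge0.
have S0 : 0 <= K / (e * eps) by rewrite divr_ge0// mulr_ge0// ltW.
apply: le_trans (bound _ S0) _.
have -> : K / (e * eps) * eps = K / e by field; rewrite !gt_eqF.
rewrite mulrAC -/K ler_pdivrMr; last by rewrite ltr_pwDl// divr_ge0// ltW.
by rewrite mulrDr mulr1 mulrCA divff ?gt_eqF// mulr1 lerDr ltW.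
Qed.

Let H : set R[i] := [set z | complex.Re z <= 0].
Let borel_H : borel_set H. Proof. exact: borel_Re_le. Qed.
Let borel_sigma : borel_set sigma. Proof. exact: borel_spectrum hA. Qed.

(** The open right half plane is exhausted by bounded sets that stay away from the
    imaginary axis. *)
Lemma solution_left_half_plane t : 0 <= t -> E H (y t) = y t.
Proof.
move=> t0.
pose D := exhaustion sigma (@complex.Re R).
have mD n : borel_set (D n) by apply: borel_exhaustion => //; exact: Re_dist.
have D0 n : E (D n) (y t) = 0.
  apply: (@solution_unstable _ n%:R n.+1%:R^-1) => //.
  - by move=> z [[]].
  - by move=> z [[_]].
  - by move=> z [].
have UE : \bigcup_n D n = ~` H `&` sigma.
  rewrite bigcup_exhaustion setIC; congr (_ `&` _).
  by apply/seteqP; split=> z /=; rewrite ltNge => /negP.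
have h : E (~` H) (y t) = 0.
  rewrite -(spec_spectrum hA) -/sigma; last exact: borel_setC.
  rewrite -UE; apply: le0_nm_eq0 => e e0.
  have := nm_cvgn (spec_cvg_nondecreasing hE (x := y t) mD
    (@exhaustion_nondecreasing _ _ _)) e0.
  by move=> [n /(_ n (leqnn n))]; rewrite D0 sub0r nmN.
by move: h; rewrite (spec_setC hE)// => /eqP; rewrite subr_eq0 => /eqP.
Qed.

(** On bounded subsets of the closed left half plane this is the case [eps = 0] of
    the decay estimate. As the constant is the same for all of them, it
    passes to their union. *)
Lemma solution_uniform D t : borel_set D -> 0 <= t ->
  nm (E D (y t)) <= 2 * C * nm (E D (y 0)).
Proof.
move=> mD t0; pose B n := D `&` H `&` sigma `&` [set z | normc z <= n%:R].
have mB n : borel_set (B n) by do 3?apply: borel_setI => //; exact: borel_disc.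
have sB n : B n `<=` B n.+1 by apply: setIS; exact: sub_disc.
have UE : \bigcup_n B n = D `&` H `&` sigma.
  apply/seteqP; split=> z; first by case=> n _ [].
  by move=> h; have [n hn] := ex_nat_ge (normc z); exists n.
have red s : 0 <= s -> E (D `&` H `&` sigma) (y s) = E D (y s).
  move=> s0; rewrite (spec_spectrum hA); last exact: borel_setI.
  by rewrite -(specI hE)// solution_left_half_plane.
have cvgB s : 0 <= s -> E (B n) (y s) @[n --> \oo] --> E D (y s).
  move=> s0; rewrite -red// -UE.
  exact: spec_cvg_nondecreasing.
have Bn n : nm (E (B n) (y t)) <= 2 * C * nm (E (B n) (y 0)).
  have := @solution_decay (B n) n%:R 0 (mB n); rewrite oppr0.
  have Bs : B n `<=` sigma by move=> z [[_]].
  have BH z : B n z -> complex.Re z <= 0 by move=> [[[]]].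
  move=> /(_ Bs (fun z => @proj2 _ _) (lexx _) BH t t0).
  by rewrite mulr0 addr0 divr1.
apply/ler_addgt0Pr => e e0.
have c0 : 0 < 2 * C + 1 by rewrite ltr_wpDl// mulr_ge0.
have p0 := divr_gt0 e0 c0; set p := e / _ in p0.
have [N1 h1] := nm_cvgn (cvgB t t0) p0.
have [N2 h2] := nm_cvgn (cvgB 0 (lexx _)) p0.
pose n := maxn N1 N2.
have {}h1 := h1 n (leq_maxl _ _); have {}h2 := h2 n (leq_maxr _ _).
have h3 := Bn n; rewrite nm_distC in h1.
have := nmD (E D (y t) - E (B n) (y t)) (E (B n) (y t)); rewrite subrK.
have h4 := nmD (E (B n) (y 0) - E D (y 0)) (E D (y 0)); rewrite subrK in h4.
have h5 : 2 * C * nm (E (B n) (y 0)) <= 2 * C * (p + nm (E D (y 0))).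
  by rewrite ler_wpM2l ?mulr_ge0//; lra.
have : (2 * C + 1) * p = e by rewrite /p mulrC divfK// gt_eqF.
lra.
Qed.

End bounded_solutions.

Section spectral_projection.
Context {R : realType} {X : completeNormedModType R[i]}.
Context (A : partial_op X) (E : set R[i] -> {linear X -> X}).
Context (hA : scalar_type_spectral A E).

Let hE : spectral_measure E. Proof. by case: hA. Qed.
Let sigma := spectrum A.
Let annulus := exhaustion sigma (@normc R).

Lemma annulus_le n z : annulus n z -> normc z <= n%:R.
Proof. by case=> [[_]]. Qed.

Lemma annulus_ge n z : annulus n z -> n.+1%:R^-1 <= normc z.
Proof. by case. Qed.

Lemma annulus_sub n : annulus n `<=` sigma.
Proof. by move=> z [[]]. Qed.

Lemma borel_annulus n : borel_set (annulus n).
Proof.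
apply: borel_exhaustion; [exact: borel_spectrum hA|exact: normc_dist].
Qed.

Lemma annulus_bounded_below n : exists2 K : R, 0 <= K &
  forall x, E (annulus n) x = x -> nm x <= K * nm (A x).
Proof.
apply: (app_bounded_below hA (borel_annulus n) (@annulus_sub n)
  (@annulus_le n) _ (@annulus_ge n)).
by rewrite invr_gt0.
Qed.

Lemma spec_compl0 x : E (sigma `&` [set z | 0 < normc z]) x = x - E [set 0] x.
Proof.
rewrite -(spec_setC hE)//; last exact: borel_set1.
rewrite -(spec_spectrum hA (D := ~` [set 0])); last exact: (borel_setC (borel_set1 0)).
rewrite setIC; congr (E (_ `&` _) x); apply/seteqP; split=> z /=.
  by move=> + z0; rewrite z0 normc0 ltxx.
by move=> z0; rewrite lt_def normc_ge0 andbT; apply/eqP => /eq0_normc.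
Qed.

Lemma cvg_annulus x : E (annulus n) x @[n --> \oo] --> x - E [set 0] x.
Proof.
rewrite -spec_compl0 -bigcup_exhaustion.
exact: (spec_cvg_nondecreasing hE (x := x) borel_annulus (@exhaustion_nondecreasing _ _ _)).
Qed.

(** Both equalities rest on the annuli [annulus n], on which [A] is bounded below and
    has dense range, and on [E (annulus n) x] tending to [x - E [set 0] x]. *)
Lemma spec0_projection :
  projection_onto_along (E [set 0]) (op_ker A) (closure (op_range A)).
Proof.
have [M M0 hM] := spec_uniform_bounded hE.
have m0 := @borel_set1 R 0.
split=> [x||].
- exact: spec_id.
- apply/seteqP; split=> x; first by move=> [u _ <-]; exact: app_spec0.
  move=> [domx Ax0]; exists x => //.
  apply/esym/eqP; rewrite -subr_eq0; apply/eqP/le0_nm_eq0 => e e0.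
  have [n /(_ n (leqnn n))] := nm_cvgn (@cvg_annulus x) e0.
  suff -> : E (annulus n) x = 0 by rewrite sub0r nmN.
  have [K K0 hK] := annulus_bounded_below n.
  have := hK (E (annulus n) x); rewrite spec_id//; last exact: borel_annulus.
  have [_ ->] := dom_spec hA (borel_annulus n) domx.
  rewrite Ax0 linear0 nm0 mulr0 => /(_ erefl) h.
  by apply: nm_eq0; apply/eqP; rewrite eq_le h nm_ge0.
- apply/seteqP; split=> x /=.
    move=> Px0 U Ux; have := @cvg_annulus x.
    rewrite Px0 subr0 => /(_ _ (@nbhs_interior _ _ _ Ux)).
    move=> [n _ /(_ n (leqnn n))] /= EnU.
    apply: (range_dense hA (borel_annulus n) (@annulus_sub n) (@annulus_le n) _
      (@annulus_ge n)) EnU => //.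
    by rewrite spec_id//; exact: borel_annulus.
  move=> clx; apply: le0_nm_eq0 => e e0.
  have M1 : 0 < M + 1 by rewrite ltr_wpDl.
  have p0 := divr_gt0 e0 M1; set p := e / _ in p0.
  have Ux : nbhs x (ball x (p%:C)) by apply: nbhsx_ballx; rewrite ltcR.
  have [_ [[u domu <-]]] := clx _ Ux.
  rewrite -ball_normE /ball_ /= nmE ltcR => /ltW xu.
  have PA : E [set 0] (A u) = 0.
    have [_ <-] := dom_spec hA m0 domu.
    by have [] := app_spec0 hA u.
  rewrite -[E _ x]subr0 -PA -linearB; apply: le_trans (hM _ _ m0) _.
  have := ler_wpM2l M0 xu; have : (M + 1) * p = e by rewrite /p mulrC divfK// gt_eqF.
  lra.
Qed.

(** The component at [0] is constant. On an annulus [A] is bounded below and maps the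
    integral to the bounded function [y t - y 0], so that the integral
    remains bounded. The rest is small uniformly in time. *)
Lemma bounded_solution_mean (y : R -> X) : bounded_weak_solution A y ->
  (t^-1)%:C *: riemann_integral y 0 t @[t --> +oo] --> E [set 0] (y 0).
Proof.
move=> [hy [Y0 hY0]].
have hY t : 0 <= t -> nm (y t) <= Y0 by move=> /hY0; rewrite nmE lecR.
have cy : {within `[0, +oo[, continuous y} by case: hy.
have [M M0 hM] := spec_uniform_bounded hE.
have [C C0 hC] := simple_integral_bounded hE.
set I := riemann_integral y 0; set P := E [set 0].
have m0 := @borel_set1 R 0.
have I0 : I 0 = 0 by have [] := riemann_integral_primitive cy (lexx 0).
pose V := sigma `&` [set z | 0 < normc z].
have mV : borel_set V.
  by rewrite /V -bigcup_exhaustion; apply: borel_bigcup; exact: borel_annulus.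
apply/nm_cvgP => e e0.
have c0 : 0 < 4 * (C + 1) by rewrite mulr_gt0// ltr_wpDl.
have p0 := divr_gt0 e0 c0; set p := e / _ in p0.
have [n hn] : exists n, nm (E (V `\` annulus n) (y 0)) <= p.
  have [n /(_ n (leqnn n)) h] := nm_cvgn (@cvg_annulus (y 0)) p0; exists n.
  rewrite (spec_diff hE) ?spec_compl0; [|exact: borel_annulus|exact: mV|].
    by rewrite nm_distC.
  by rewrite /V -bigcup_exhaustion => z nz; exists n.
have mVn : borel_set (V `\` annulus n) by apply: borel_setD => //; exact: borel_annulus.
have [K K0 hK] := annulus_bounded_below n.
have split3 x : x = P x + E (annulus n) x + E (V `\` annulus n) x.
  rewrite (spec_diff hE)//; [|exact: borel_annulus|].
    by rewrite [RHS]addrC addrCA subrK spec_compl0 addrC subrK.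
  by rewrite /V -bigcup_exhaustion => z nz; exists n.
have PI t : 0 <= t -> P (I t) = t%:C *: P (y 0).
  move=> t0; apply/eqP; rewrite -subr_eq0; apply/eqP/le0_nm_eq0 => d d0.
  have := riemann_integral_linear (L := P) (v := P (y 0)) (c := 0) cy M0
    (fun x => hM _ x m0) (lexx _) t0.
  rewrite mulr0 -/I I0 linear0 !subr0 => h; apply: le_trans (h _) (ltW d0).
  by move=> s /andP[s0 _]; rewrite /P (solution_spec0 hA hy s0) subrr nm0.
have VI t : 0 <= t -> nm (E (V `\` annulus n) (I t)) <= t * (2 * C * p).
  move=> t0.
  have := riemann_integral_linear (L := E (V `\` annulus n)) (v := 0)
    (c := 2 * C * p) cy M0 (fun x => hM _ x mVn) (lexx _) t0.
  rewrite -/I I0 [E _ 0]linear0 scaler0 !subr0 => h; apply: h => s /andP[s0 _]; rewrite ?subr0.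
  apply: le_trans (solution_uniform hA M0 hM hy hY C0 hC mVn s0) _.
  by rewrite ler_wpM2l// mulr_ge0.
have DI t : 0 <= t -> nm (E (annulus n) (I t)) <= K * (M * (Y0 + Y0)).
  move=> t0; apply: le_trans (hK (E (annulus n) (I t)) _) _.
    by rewrite spec_id//; exact: borel_annulus.
  rewrite ler_wpM2l//; have [_ ->] := solution_spec hA hy (borel_annulus n) t0.
  rewrite -linearB; apply: le_trans (hM _ _ (borel_annulus n)) _.
  by rewrite ler_wpM2l// (le_trans (nmB _ _))// lerD ?hY.
pose Q := K * (M * (Y0 + Y0)).
have Q0 : 0 <= Q.
  by rewrite !mulr_ge0// addr_ge0// (le_trans (nm_ge0 _) (hY 0 (lexx _))).
near=> t.
have t0 : 0 < t by near: t; exact: nbhs_pinfty_gt.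
have tQ : 2 * Q / e <= t by near: t; apply: nbhs_pinfty_ge; rewrite num_real.
rewrite {1}[I t]split3 !scalerDr (PI _ (ltW t0)) scalerA -rmorphM /= mulVf ?gt_eqF//.
rewrite scale1r [X in nm X]addrC [X in nm X]addrA addKr; apply: le_trans (nmD _ _) _.
rewrite !nmZr gtr0_norm ?invr_gt0// -mulrDr mulrC ler_pdivrMr//.
have h1 := DI t (ltW t0); have h2 := VI t (ltW t0); rewrite -/Q in h1.
have h3 : 2 * Q <= e * t by rewrite [e * t]mulrC -ler_pdivrMr.
have h4 : 4 * (C + 1) * p = e by rewrite /p mulrC divfK// gt_eqF.
have h5 : t * (2 * C * p) <= e * t / 2.
  have : 0 <= t * p by rewrite mulr_ge0// ltW.
  by rewrite -h4; lra.
lra.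
Unshelve. all: by end_near. Qed.

(** In the absence of imaginary spectrum the part of the spectrum that carries the
    solution is [0] together with a subset of the open left half plane, which is
    exhausted by sets on which the solution decays. *)
Lemma bounded_solution_cvg (y : R -> X) : spectrum A `&` pure_imaginary = set0 ->
  bounded_weak_solution A y -> y t @[t --> +oo] --> E [set 0] (y 0).
Proof.
move=> noimag [hy [Y0 hY0]].
have hY t : 0 <= t -> nm (y t) <= Y0 by move=> /hY0; rewrite nmE lecR.
have [M M0 hM] := spec_uniform_bounded hE.
have [C C0 hC] := simple_integral_bounded hE.
have m0 := @borel_set1 R 0.
pose l z := - complex.Re (z : R[i]).
have hl z w : `|l z - l w| <= normc (z - w) by rewrite -opprD normrN Re_dist.
pose D := exhaustion sigma l.
have mD n : borel_set (D n) by apply: borel_exhaustion => //; exact: borel_spectrum hA.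
pose U := sigma `&` [set z | 0 < l z].
have UE : \bigcup_n D n = U by exact: bigcup_exhaustion.
have mU : borel_set U by rewrite -UE; exact: borel_bigcup.
have sU n : D n `<=` U by rewrite -UE => z Dz; exists n.
have compl t : 0 <= t -> y t = E [set 0] (y 0) + E U (y t).
  move=> t0; rewrite -(solution_spec0 hA hy t0).
  rewrite -{1}[y t](subrKC (E [set 0] (y t))) -spec_compl0.
  rewrite -{2}(solution_left_half_plane hA M0 hM hy hY C0 hC t0).
  have mH : borel_set [set z : R[i] | complex.Re z <= 0] by exact: borel_Re_le.
  have mV : borel_set (sigma `&` [set z | 0 < normc z]).
    by rewrite -bigcup_exhaustion; apply: borel_bigcup; exact: borel_annulus.
  rewrite (specI hE)//; congr (_ + E _ _); apply/seteqP; split=> z /=; last first.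
    rewrite /U /l /= oppr_gt0 => -[sz z0]; split; last exact: ltW.
    split=> //; rewrite lt_def normc_ge0 andbT; apply/eqP => /eq0_normc zz.
    by rewrite zz ltxx in z0.
  move=> [[sz z0] zR]; split=> //=; rewrite /l oppr_gt0 lt_neqAle zR andbT.
  apply/eqP => z1; suff : (spectrum A `&` pure_imaginary) z by rewrite noimag.
  split=> //; exists (complex.Im z); last by case: z z1 {sz z0 zR} => a b /= ->.
  apply/eqP => z2; move: z0; case: z z1 z2 {sz zR} => a b /= -> ->.
  by rewrite expr0n addr0 sqrtr0 ltxx.
apply/nm_cvgP => e e0.
have c0 : 0 < 4 * (C + 1) by rewrite mulr_gt0// ltr_wpDl.
have p0 := divr_gt0 e0 c0; set p := e / _ in p0.
have [n hn] : exists n, nm (E (U `\` D n) (y 0)) <= p.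
  have := spec_cvg_nondecreasing hE (x := y 0) mD (@exhaustion_nondecreasing _ _ _).
  rewrite UE => /nm_cvgn/(_ p p0)[n /(_ n (leqnn n)) h]; exists n.
  by rewrite (spec_diff hE)// nm_distC.
pose Q := 2 * C * nm (E (D n) (y 0)).
have Q0 : 0 <= Q by rewrite !mulr_ge0// nm_ge0.
near=> t.
have t0 : 0 < t by near: t; exact: nbhs_pinfty_gt.
have tQ : 2 * Q / e / n.+1%:R^-1 <= t by near: t; apply: nbhs_pinfty_ge; rewrite num_real.
have i0 : (0 : R) < n.+1%:R^-1 by rewrite invr_gt0.
rewrite (compl _ (ltW t0)) addrC addKr.
have -> : E U (y t) = E (D n) (y t) + E (U `\` D n) (y t).
  by rewrite (spec_diff hE)// addrC subrK.
apply: le_trans (nmD _ _) _; rewrite [e]splitr; apply: lerD.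
  have := solution_decay hA M0 hM hy hY C0 hC (mD n) (N := n%:R) (eps := n.+1%:R^-1).
  move=> /(_ _ _ (ltW i0) _ t (ltW t0)) h.
  apply: le_trans (h _ _ _) _.
  - by move=> z [[]].
  - by move=> z [[_]].
  - by move=> z [_ /=]; rewrite /l lerNr.
  rewrite ler_pdivrMr// in tQ; move: i0 tQ; set i := _^-1 => i0 tQ.
  rewrite ler_pdivrMr// in tQ.
  have ti : 0 < 1 + t * i by rewrite ltr_pwDl// mulr_ge0// ltW.
  rewrite mulrAC -/Q ler_pdivrMr//.
  have : 0 <= e by exact: ltW.
  lra.
have mUn : borel_set (U `\` D n) by exact: borel_setD.
apply: le_trans (solution_uniform hA M0 hM hy hY C0 hC mUn (ltW t0)) _.
apply: le_trans (ler_wpM2l _ hn) _; first by rewrite mulr_ge0.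
have h4 : 4 * (C + 1) * p = e by rewrite /p mulrC divfK// gt_eqF.
lra.
Unshelve. all: by end_near. Qed.

End spectral_projection.

Theorem theorem7p3 (R : realType) (X : completeNormedModType R[i])
    (A : partial_op X) (E : set R[i] -> {linear X -> X})
    (hA : scalar_type_spectral A E) :
  let P := E [set 0] in
  [/\ projection_onto_along P (op_ker A) (closure (op_range A)),
      forall y : R -> X, bounded_weak_solution A y ->
        (t^-1)%:C *: riemann_integral y 0 t @[t --> +oo] --> P (y 0)
    & spectrum A `&` pure_imaginary = set0 ->
      forall y : R -> X, bounded_weak_solution A y ->
        y t @[t --> +oo] --> P (y 0)].
Proof.
move=> P; split.
- exact: spec0_projection.
- exact: bounded_solution_mean.
- move=> noimag y; exact: bounded_solution_cvg.
Qed.
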